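(* Let $X$ be a metric space with a cocompact action of a discrete group $G$ by isometries, and let $t>0$. Assume that every ball in $X$ is finite. Assume that there exists a $G$-equivariant map (of sets) $\zeta\colon\mathcal{P}_{\mathrm{fn}}(X)\to\mathcal{P}_{\mathrm{fn}}(X)$ such that the following conditions hold for all $S\in\mathcal{P}_{\mathrm{fn}}(X)$ with $\operatorname{diam}(S)>t$: (1) if $\zeta(S)\subseteq S$ then $\operatorname{diam}(\zeta(S))<\operatorname{diam}(S)$, and for all $S^\vee\in\mathcal{P}_{\mathrm{fn}}(X)$ with $S^\vee\subseteq S$ and $\operatorname{diam}(S^\vee)<\operatorname{diam}(S)$ also $\operatorname{diam}(S^\vee\cup\zeta(S))<\operatorname{diam}(S)$; (2) if $\zeta(S)\not\subseteq S$ then for all $S^\wedge\in\mathcal{P}_{\mathrm{fn}}(X)$ with $S^\wedge\supseteq S$ and $\operatorname{diam}(S^\wedge)=\operatorname{diam}(S)$ also $\operatorname{diam}(S^\wedge\cup\zeta(S))=\operatorname{diam}(S)$. Then for any $S\in\mathcal{P}_{\mathrm{fn}}(X)$ with $\operatorname{diam}(S)>t$ the descending link $\operatorname{lk}_\downarrow S$ is $\operatorname{Stab}_G(S)$-contractible, and $\mathcal{VR}_t(X)$ is $G$-homotopy equivalent to $\mathcal{VR}_\infty(X)$.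
   Context: The geometric realization $|\mathcal{P}|$ of a poset $\mathcal{P}$ is the geometric realization of its order complex, the abstract simplicial complex whose vertices are the elements of $\mathcal{P}$ and whose simplices are the finite nonempty chains. A group action on $\mathcal{P}$ by order-preserving maps induces an action on $|\mathcal{P}|$. $\mathcal{P}_{\mathrm{fn}}(X)$ is the poset of finite nonempty subsets of $X$ ordered by inclusion, with the induced $G$-action. For $t\in\mathbb{R}$, $\mathcal{P}_{\mathrm{fn}}^{\le t}(X)=\{S\in\mathcal{P}_{\mathrm{fn}}(X)\mid\operatorname{diam}(S)\le t\}$. Set $\mathcal{VR}_\infty(X)=|\mathcal{P}_{\mathrm{fn}}(X)|$ and $\mathcal{VR}_t(X)=|\mathcal{P}_{\mathrm{fn}}^{\le t}(X)|$ (the Vietoris--Rips complex), with the induced $G$-actions. $\operatorname{Stab}_G(S)$ is the setwise stabilizer $\{g\in G\mid g\cdot S=S\}$. Descending links are taken with respect to the Morse function on $\mathcal{VR}_\infty(X)$ that orders vertices $S\in\mathcal{P}_{\mathrm{fn}}(X)$ by $(\operatorname{diam}(S),-\operatorname{card}(S))$ in the lexicographic order. Explicitly, $\operatorname{lk}_\downarrow S$ is the geometric realization of the subposet of $\mathcal{P}_{\mathrm{fn}}(X)$ consisting of all $T\neq S$ that are comparable to $S$ (under inclusion) and satisfy $(\operatorname{diam}(T),-\operatorname{card}(T))<(\operatorname{diam}(S),-\operatorname{card}(S))$ lexicographically; equivalently, of all nonempty $T\subseteq S$ with $\operatorname{diam}(T)<\operatorname{diam}(S)$ together with all finite $T\supsetneq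 S$ with $\operatorname{diam}(T)=\operatorname{diam}(S)$. It carries the induced $\operatorname{Stab}_G(S)$-action. For a group $H$, an $H$-space is $H$-contractible if it is $H$-homotopy equivalent to a point. The action of $G$ on $X$ is cocompact if there is a compact $K\subseteq X$ with $X=G\cdot K$. *)

(* Defs.v *)
From HB Require Import structures.
From mathcomp Require Import all_boot all_order all_algebra finmap.
From mathcomp Require Import all_classical all_reals topology normedtype.

Set Implicit Arguments.
Unset Strict Implicit.
Unset Printing Implicit Defensive.

Import Order.TTheory GRing.Theory Num.Theory.
Import numFieldNormedType.Exports.

Local Open Scope classical_set_scope.
Local Open Scope fset_scope.
Local Open Scope ring_scope.

(* mathcomp's [{action aT &-> T}] requires a finite group. The groups are
   discrete, so that there is no continuity condition with respect to G. *)
Record gact (G : groupType) (T : Type) := GAct {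
  act :> G -> T -> T;
  act1 : forall x, act 1%g x = x;
  actM : forall g h x, act (g * h)%g x = act g (act h x) }.

Definition equivariant (G : groupType) (T U : Type)
    (a : gact G T) (b : gact G U) (f : T -> U) :=
  forall g x, f (a g x) = b g (f x).

Definition trivial_act (G : groupType) (T : Type) : gact G T :=
  @GAct G T (fun _ x => x) (fun=> erefl) (fun _ _ _ => erefl).

Section Stabilizer.
Context (G : groupType) (T : eqType) (a : gact G T) (x : T).

Definition stab_pred : pred G := fun g => a g x == x.

Record stab := Stab { stab_val :> G; stab_valP : stab_pred stab_val }.

HB.instance Definition _ := [isSub for stab_val].
HB.instance Definition _ := [Choice of stab by <:].

Lemma stab_group_closed : group_closed stab_pred.
Proof.
split; first by apply/eqP; exact: act1.
move=> g h /eqP gx /eqP hx; apply/eqP.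
have hVx : a h^-1%g x = x by rewrite -{1}hx -actM mulVg act1.
by rewrite actM hVx gx.
Qed.

HB.instance Definition _ :=
  SubChoice_isSubGroup.Build G stab_pred stab stab_group_closed.

End Stabilizer.

Section RestrictedActions.
Context (G : groupType) (T : Type) (a : gact G T).

Definition sub_act (p : pred T) (sT : subType p)
    (a_p : forall g x, p x -> p (a g x)) : gact G sT.
Proof.
exists (fun g (x : sT) => Sub (a g (val x)) (a_p g _ (valP x))).
- by move=> x; apply: val_inj; rewrite SubK act1.
- by move=> g h x; apply: val_inj; rewrite !SubK actM.
Defined.

End RestrictedActions.

Section StabilizerAction.
Context (G : groupType) (T : eqType) (a : gact G T) (x : T).

Lemma stab_act1 y : a (val (1%g : stab a x)) y = y.
Proof. by rewrite val1 act1. Qed.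

Lemma stab_actM (g h : stab a x) y :
  a (val (g * h)%g) y = a (val g) (a (val h) y).
Proof. by rewrite valM actM. Qed.

Definition stab_act : gact (stab a x) T :=
  @GAct (stab a x) T (fun h => a (val h)) stab_act1 stab_actM.

End StabilizerAction.

Section EquivariantHomotopy.
Context (R : realType) (G : groupType) (T U : topologicalType).
Context (a : gact G T) (b : gact G U).

Definition G_homotopic (f0 f1 : T -> U) :=
  exists H : T * R -> U,
    [/\ {within [set z | z.2 \in `[0, 1]], continuous H},
        forall x, H (x, 0) = f0 x,
        forall x, H (x, 1) = f1 x &
        forall s, s \in `[0, 1] -> equivariant a b (fun x => H (x, s))].

End EquivariantHomotopy.

Definition G_homotopy_equiv (R : realType) (G : groupType)
    (T U : topologicalType) (a : gact G T) (b : gact G U) :=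
  exists (f : T -> U) (h : U -> T),
    [/\ continuous f /\ equivariant a b f,
        continuous h /\ equivariant b a h,
        G_homotopic R a a (h \o f) id &
        G_homotopic R b b (f \o h) id].

Definition G_contractible (R : realType) (G : groupType)
    (T : topologicalType) (a : gact G T) :=
  G_homotopy_equiv R a (trivial_act G (discrete_topology unit)).

Section Realization.
Context (R : realType) (d : Order.disp_t) (P : porderType d).

Definition chain (A : {fset P}) : bool := all2rel Order.comparable A.

(* A point of the realization is given by its barycentric coordinates, which
   are supported on a simplex of the order complex. *)
Definition barycentric (w : {fsfun P -> R with 0}) : bool :=
  [&& chain (finsupp w),
      all (fun p => 0 <= w p) (finsupp w) &
      \sum_(p <- finsupp w) w p == 1].

Record realization := Realization {
  bary :> {fsfun P -> R with 0};
  baryP : barycentric bary }.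

HB.instance Definition _ := [isSub for bary].
HB.instance Definition _ := [Choice of realization by <:].

(* Weak topology: U is open iff, for every simplex A, its trace on A is open
   for the Euclidean topology, here given by the sup distance between
   coordinates. *)
Definition realization_open (U : set realization) :=
  forall A : {fset P}, chain A ->
  forall u : realization, finsupp u `<=` A -> U u ->
  exists2 e : R, 0 < e &
    forall v : realization, finsupp v `<=` A ->
      (forall p, p \in A -> `|u p - v p| < e) -> U v.

Lemma realization_openT : realization_open setT.
Proof. by move=> A _ u _ _; exists 1. Qed.

Lemma realization_openI : setI_closed realization_open.
Proof.
move=> U V oU oV A cA u uA [Uu Vu].
have [e e0 eU] := oU A cA u uA Uu; have [e' e'0 eV] := oV A cA u uA Vu.
exists (Num.min e e'); first by rewrite lt_min e0.
move=> v vA uv; split; [apply: eU|apply: eV] => // p /uv;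
  by rewrite lt_min => /andP[].
Qed.

Lemma realization_open_bigU (I : Type) (f : I -> set realization) :
  (forall i, realization_open (f i)) -> realization_open (\bigcup_i f i).
Proof.
move=> of_ A cA u uA [i _ fiu]; have [e e0 eU] := of_ i A cA u uA fiu.
by exists e => // v vA uv; exists i => //; exact: eU.
Qed.

HB.instance Definition _ := isOpenTopological.Build realization
  realization_openT realization_openI realization_open_bigU.

Lemma realization_openE (U : set realization) : open U = realization_open U.
Proof. by []. Qed.

Lemma realization_sumE (w : realization) (Q : pred P) (A : {fset P}) :
  finsupp w `<=` A ->
  \sum_(p <- finsupp w | Q p) w p = \sum_(p <- A | Q p) w p.
Proof.
move=> wA; rewrite big_mkcond [RHS]big_mkcond; apply: big_fset_incl => // p _.
by move=> /fsfun_dflt->; case: ifP.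
Qed.

Lemma realization_ge0 (w : realization) p : 0 <= w p.
Proof.
case: (finsuppP w p) => // pw.
by have /and3P[_ /allP/(_ _ pw)] := baryP w.
Qed.

End Realization.

Lemma imfset_mono (S T : choiceType) (f : S -> T) (A B : {fset S}) :
  A `<=` B -> f @` A `<=` f @` B.
Proof.
move=> /fsubsetP AB; apply/fsubsetP => _ /imfsetP[x /= /AB xB ->].
exact: in_imfset.
Qed.

Section RealizationMap.
Context (R : realType) (d d' : Order.disp_t).
Context (P : porderType d) (Q : porderType d') (f : P -> Q).
Hypothesis f_homo : {homo f : x y / (x <= y)%O}.

(* The affine extension of f to simplices. *)
Definition rmap_fsfun (w : realization R P) : {fsfun Q -> R with 0} :=
  [fsfun q in f @` finsupp w => \sum_(p <- finsupp w | f p == q) w p].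

Lemma rmap_fsfunE w q :
  rmap_fsfun w q = \sum_(p <- finsupp w | f p == q) w p.
Proof.
rewrite fsfun_fun; case: ifPn => // qw; rewrite big_seq_cond big1// => p.
by move=> /andP[pw /eqP fp]; case/negP: qw; rewrite -fp; apply: in_imfset.
Qed.

Lemma finsupp_rmap_fsfun w : finsupp (rmap_fsfun w) `<=` f @` finsupp w.
Proof. exact: finsupp_sub. Qed.

Lemma rmap_subproof w : barycentric (rmap_fsfun w).
Proof.
have /and3P[cw w0 /eqP w1] := baryP w; apply/and3P; split.
- apply/allrelP => x y /(fsubsetP (finsupp_rmap_fsfun w)) /imfsetP[p /= pw ->].
  move=> /(fsubsetP (finsupp_rmap_fsfun w)) /imfsetP[q /= qw ->].
  by have /orP[/f_homo|/f_homo] := allrelP cw p q pw qw;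
    rewrite /Order.comparable => ->; rewrite ?orbT.
- apply/allP => q _; rewrite rmap_fsfunE; apply: sumr_ge0 => p _.
  exact: realization_ge0.
- have -> : \sum_(q <- finsupp (rmap_fsfun w)) rmap_fsfun w q =
            \sum_(q <- f @` finsupp w) rmap_fsfun w q.
    apply: big_fset_incl; first exact: finsupp_rmap_fsfun.
    by move=> q _ /fsfun_dflt->.
  under eq_bigr do rewrite rmap_fsfunE.
  rewrite (exchange_big_dep xpredT)//= -w1; apply/eqP.
  rewrite big_seq [RHS]big_seq; apply: eq_bigr => p pw.
  rewrite big_mkcond (bigD1_seq (f p)) ?in_imfset ?fset_uniq//= eqxx.
  by rewrite big1 ?addr0// => q; rewrite eq_sym => /negPf->.
Qed.

Definition rmap (w : realization R P) : realization R Q :=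
  Realization (rmap_subproof w).

Lemma rmapE w q : rmap w q = \sum_(p <- finsupp w | f p == q) w p.
Proof. exact: rmap_fsfunE. Qed.

Lemma finsupp_rmap w : finsupp (rmap w) `<=` f @` finsupp w.
Proof. exact: finsupp_rmap_fsfun. Qed.

Lemma rmap_continuous : continuous rmap.
Proof.
apply/continuousP => U; rewrite !realization_openE => oU A cA u uA Uu.
have cfA : chain (f @` A).
  apply/allrelP => x y /imfsetP[p /= pA ->] /imfsetP[q /= qA ->].
  by have /orP[/f_homo|/f_homo] := allrelP cA p q pA qA;
    rewrite /Order.comparable => ->; rewrite ?orbT.
have supp_fA (v : realization R P) :
    finsupp v `<=` A -> finsupp (rmap v) `<=` f @` A.
  by move=> vA; apply: fsubset_trans (finsupp_rmap v) (imfset_mono _ _).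
have [e e0 eU] := oU _ cfA _ (supp_fA _ uA) Uu.
have n0 : 0 < #|` A|.+1%:R :> R by rewrite ltr0n.
exists (e / #|` A|.+1%:R) => [|v vA uv]; first by rewrite divr_gt0.
apply: eU => [|q _]; first exact: supp_fA.
rewrite !rmapE (realization_sumE _ uA) (realization_sumE _ vA) -sumrB.
apply: le_lt_trans (ler_norm_sum _ _ _) _.
apply: (@le_lt_trans _ _ (\sum_(p <- A) e / #|` A|.+1%:R)).
  rewrite big_mkcond big_seq [leRHS]big_seq; apply: ler_sum => p pA.
  by case: ifP => _; [exact/ltW/uv|rewrite divr_ge0 ?ltW].
rewrite big_const_seq count_predT iter_addr_0.
by rewrite -mulrnAl ltr_pdivrMr// -[X in X < _]mulr_natr ltr_pM2l// ltr_nat.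
Qed.

End RealizationMap.

Section RealizationFunctor.
Context (R : realType).

Lemma realizationP d (P : porderType d) (u v : realization R P) :
  (forall p, u p = v p) -> u = v.
Proof. by move=> uv; apply/val_inj/fsfunP. Qed.

Lemma rmap_id d (P : porderType d) (f : P -> P)
    (hf : {homo f : x y / (x <= y)%O}) w :
  f =1 id -> @rmap R _ _ _ _ f hf w = w.
Proof.
move=> fid; apply: realizationP => p; rewrite rmapE.
under eq_bigl do rewrite fid.
rewrite big_mkcond; case: (boolP (p \in finsupp w)) => pw.
  rewrite (bigD1_seq p) ?fset_uniq//= eqxx big1 ?addr0// => q.
  by move=> /negPf->.
rewrite fsfun_dflt// big_seq big1// => q qw.
by case: eqP => // qp; rewrite -qp qw in pw.
Qed.

Lemma rmap_comp d d' d'' (P : porderType d) (Q : porderType d')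
    (S : porderType d'') (f : P -> Q) (g : Q -> S) (h : P -> S)
    (hf : {homo f : x y / (x <= y)%O}) (hg : {homo g : x y / (x <= y)%O})
    (hh : {homo h : x y / (x <= y)%O}) w :
  h =1 g \o f -> @rmap R _ _ _ _ h hh w = rmap hg (rmap hf w).
Proof.
move=> hE; apply: realizationP => s; rewrite !rmapE.
rewrite (realization_sumE _ (finsupp_rmap hf w)).
under [RHS]eq_bigr do rewrite rmapE.
rewrite (exchange_big_dep xpredT)//= big_mkcond big_seq [RHS]big_seq.
apply: eq_bigr => p pw; rewrite big_mkcond (bigD1_seq (f p)) ?fset_uniq//=.
  rewrite eqxx andbT hE /= big1 ?addr0// => q /negPf.
  by rewrite eq_sym => ->; rewrite andbF.
exact: in_imfset.
Qed.

End RealizationFunctor.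

Section RealizationAction.
Context (R : realType) (d : Order.disp_t) (P : porderType d) (G : groupType).

Definition monotone_act (a : gact G P) :=
  forall g, {homo a g : x y / (x <= y)%O}.

Context (a : gact G P) (a_mono : monotone_act a).

Lemma realization_act1 (w : realization R P) : rmap (a_mono 1%g) w = w.
Proof. by apply: rmap_id => p; exact: act1. Qed.

Lemma realization_actM g h (w : realization R P) :
  rmap (a_mono (g * h)%g) w = rmap (a_mono g) (rmap (a_mono h) w).
Proof. by apply: rmap_comp => p; exact: actM. Qed.

Definition realization_act : gact G (realization R P) :=
  @GAct G (realization R P) (fun g => rmap (a_mono g))
    realization_act1 realization_actM.

Lemma realization_act_continuous g : continuous (realization_act g).
Proof. exact: rmap_continuous. Qed.

End RealizationAction.

Section Subposet.
Context (d : Order.disp_t) (P : porderType d) (p : pred P).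

Record subposet := Subposet { subposet_val :> P; subposetP : p subposet_val }.

HB.instance Definition _ := [isSub for subposet_val].
HB.instance Definition _ := [Choice of subposet by <:].
HB.instance Definition _ := [SubChoice_isSubPOrder of subposet by <: with d].

End Subposet.

Section SubposetAction.
Context (d : Order.disp_t) (P : porderType d) (p : pred P) (G : groupType).
Context (a : gact G P) (a_mono : monotone_act a).
Context (a_p : forall g x, p x -> p (a g x)).

Definition subposet_act : gact G (subposet p) := sub_act (subposet p) a_p.

Lemma subposet_act_mono : monotone_act subposet_act.
Proof. by move=> g x y; exact: (a_mono g (x := val x) (y := val y)). Qed.

End SubposetAction.

Fact Pfn_display : Order.disp_t. Proof. exact: Order.Disp tt tt. Qed.

Section FiniteNonemptySubsets.
Context (X : choiceType).

Record Pfn := MkPfn { Pfn_val :> {fset X}; PfnP : Pfn_val != fset0 }.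

HB.instance Definition _ := [isSub for Pfn_val].
HB.instance Definition _ := [Choice of Pfn by <:].

Definition Pfn_le (S T : Pfn) : bool := Pfn_val S `<=` Pfn_val T.

Lemma Pfn_le_refl : reflexive Pfn_le.
Proof. by move=> S; exact: fsubset_refl. Qed.

Lemma Pfn_le_anti : antisymmetric Pfn_le.
Proof. by move=> S T; rewrite -eqEfsubset => /eqP/val_inj. Qed.

Lemma Pfn_le_trans : transitive Pfn_le.
Proof. by move=> S T U; exact: fsubset_trans. Qed.

HB.instance Definition _ := Order.Le_isPOrder.Build Pfn_display Pfn
  Pfn_le_refl Pfn_le_anti Pfn_le_trans.

Context (G : groupType) (a : gact G X).

Lemma Pfn_act_subproof g (S : Pfn) : a g @` Pfn_val S != fset0.
Proof.
have /fset0Pn[x xS] := PfnP S.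
by apply/fset0Pn; exists (a g x); apply: in_imfset.
Qed.

Lemma Pfn_act1 S : MkPfn (Pfn_act_subproof 1%g S) = S.
Proof.
apply: val_inj => /=; apply/fsetP => x; apply/imfsetP/idP => [[y yS ->]|xS].
  by rewrite act1.
by exists x; rewrite ?act1.
Qed.

Lemma Pfn_actM g h S :
  MkPfn (Pfn_act_subproof (g * h)%g S) =
  MkPfn (Pfn_act_subproof g (MkPfn (Pfn_act_subproof h S))).
Proof.
apply: val_inj => /=; apply/fsetP => x; apply/imfsetP/imfsetP => /=.
  by move=> [y yS ->]; exists (a h y); rewrite ?actM// in_imfset.
by move=> [_ /imfsetP[y yS ->] ->]; exists y; rewrite ?actM.
Qed.

Definition Pfn_act : gact G Pfn :=
  @GAct G Pfn (fun g S => MkPfn (Pfn_act_subproof g S)) Pfn_act1 Pfn_actM.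

Lemma Pfn_act_mono : monotone_act Pfn_act.
Proof. by move=> g S T ST; exact: imfset_mono. Qed.

End FiniteNonemptySubsets.

Section VietorisRips.
Context (R : realType) (X : metricType R).

Definition diam (S : {fset X}) : R :=
  sup [set mdist x y | x in [set` S] & y in [set` S]].

(* [R *l int] carries the lexicographic order. *)
Definition morse (S : Pfn X) : R *l int := (diam S, - (#|` S|)%:Z).

Definition link_pred (S : Pfn X) : pred (Pfn X) :=
  fun T => [&& T != S, (T >=< S)%O & (morse T < morse S)%O].

Definition diam_le (t : R) : pred (Pfn X) := fun S => diam S <= t.

Definition VR (t : R) := realization R (subposet (diam_le t)).
Definition VRoo := realization R (Pfn X).
Definition lk (S : Pfn X) := realization R (subposet (link_pred S)).

HB.instance Definition _ t := Topological.on (VR t).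
HB.instance Definition _ := Topological.on VRoo.
HB.instance Definition _ S := Topological.on (lk S).

Context (G : groupType).

Definition isometric_act (a : gact G X) :=
  forall g x y, mdist (a g x) (a g y) = mdist x y.

Definition cocompact_act (a : gact G X) :=
  exists2 K : set X, compact K & forall x, exists g y, K y /\ x = a g y.

Context (a : gact G X) (a_iso : isometric_act a).

Lemma isometric_act_inj g : injective (a g).
Proof.
by move=> x y gxy; rewrite -[x](act1 a) -[y](act1 a) -(mulVg g) !actM gxy.
Qed.

Lemma diam_act g (S : Pfn X) : diam (Pfn_act a g S) = diam S.
Proof.
congr sup; apply/seteqP; split => r /=.
  move=> [_ /imfsetP[x xS ->] [_ /imfsetP[y yS ->] <-]].
  by rewrite a_iso; exists x => //; exists y.
move=> [x xS [y yS <-]]; exists (a g x); first exact: in_imfset.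
by exists (a g y); [exact: in_imfset|rewrite a_iso].
Qed.

Lemma morse_act g S : morse (Pfn_act a g S) = morse S.
Proof.
by rewrite /morse diam_act /= card_imfset//; exact: isometric_act_inj.
Qed.

Lemma diam_le_act t g S : diam_le t S -> diam_le t (Pfn_act a g S).
Proof. by rewrite /diam_le diam_act. Qed.

Definition VR_act (t : R) : gact G (VR t) :=
  realization_act R (subposet_act_mono (Pfn_act_mono a) (diam_le_act (t := t))).

Definition VRoo_act : gact G VRoo := realization_act R (Pfn_act_mono a).

Lemma link_pred_act S (g : stab (Pfn_act a) S) T :
  link_pred S T -> link_pred S (stab_act (Pfn_act a) S g T).
Proof.
have gS : Pfn_act a (val g) S = S by apply/eqP; exact: (stab_valP g).
move=> /and3P[TS cTS mTS]; apply/and3P; split.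
- apply: contraNneq TS => gT; apply/eqP.
  rewrite -[T](act1 (Pfn_act a)) -[RHS](act1 (Pfn_act a)) -(mulVg (val g)).
  by rewrite !actM gS; congr (Pfn_act a _ _).
- by apply/orP; move: cTS => /orP[] /(Pfn_act_mono a (val g)); rewrite gS;
    [left|right].
- by rewrite /= morse_act.
Qed.

Lemma stab_act_mono S : monotone_act (stab_act (Pfn_act a) S).
Proof. by move=> g; exact: Pfn_act_mono. Qed.

Definition lk_act (S : Pfn X) : gact (stab (Pfn_act a) S) (lk S) :=
  realization_act R
    (subposet_act_mono (stab_act_mono (S := S)) (link_pred_act (S := S))).

End VietorisRips.

(* Main.v *)
Require Import Defs.
From HB Require Import structures.
From mathcomp Require Import all_boot all_order all_algebra finmap.
From mathcomp Require Import lra.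
From mathcomp Require Import all_classical all_reals topology normedtype.

Set Implicit Arguments.
Unset Strict Implicit.
Unset Printing Implicit Defensive.

Import Order.TTheory GRing.Theory Num.Theory.
Import numFieldNormedType.Exports.

Local Open Scope classical_set_scope.
Local Open Scope fset_scope.
Local Open Scope ring_scope.

(** Let [S] have diameter greater than [t]. Its descending link is the
realization of the poset of the subsets of [S] of smaller diameter and of the
proper supersets of [S] of the same diameter. Put [C = zeta S] if this is
contained in [S], and [C = S `|` zeta S] otherwise. The hypotheses [zeta_in]
and [zeta_out] say that [C] and, for every [T] in this poset, also [T `|` C]
are in the poset ([link_apex], [link_join]). Since [T <= T `|` C >= C], the
link is conically contractible, and [C] is determined by [S], so the
contraction commutes with the stabilizer of [S]. The contraction is one
explicit homotopy: the mass of a point, laid out as an interval in the order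
of its chain, is moved from [T] to [T `|` C] from the top end of the interval
downwards, and then moves along straight lines to [C] ([cone],
[conical_contractible]).

For the second claim, cocompactness and the finiteness of balls leave only
finitely many Morse values below any given one, so that the finite sets of
diameter greater than [t] have a G-invariant positive [rank] which increases
with the Morse value. The part of the complex of rank at most [n] is the part
of rank less than [n] with a cone attached over the descending link of each
[S] of rank [n]. A contraction of the link is a retraction of this cone onto
its base, and these retractions together give a map [step n] that removes the
vertices of rank [n]. The composite [step 1 \o step 2 \o ...] makes sense
because every simplex has bounded rank; it is a G-equivariant [retraction] of
the complex of all finite sets onto the Vietoris-Rips complex.

A retraction is a left inverse of the inclusion. The other composite is a
G-equivariant map from the complex of all finite sets to itself, and no care
is needed to deform it to the identity: this complex is the barycentric
subdivision of the full simplex on [X], in which two equivariant maps can be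
joined by straight lines ([locally_finite_maps_homotopic]).

All maps send a finite set of vertices into the span of a finite set of
vertices, and there convergence is convergence of the coordinates
([cvg_face]). Homotopies live on a product with [[0, 1]], where continuity may
still be tested simplex by simplex since the interval is compact
([homotopy_continuous_on_faces]). *)

(** * The weak topology in coordinates *)

Section WeakTopology.
Context (R : realType) (d : Order.disp_t) (P : porderType d).
Local Notation space := (realization R P).

(** For a chain [A] this is a closed simplex; for any finite [A] it is the
subcomplex spanned by [A]. *)
Definition face (A : {fset P}) : set space := [set w | finsupp w `<=` A].

Lemma chain_finsupp (w : space) : chain (finsupp w).
Proof. by have /and3P[] := baryP w. Qed.

Lemma continuous_mass (Q : pred P) :
  continuous (fun w : space => \sum_(p <- finsupp w | Q p) w p : R).
Proof.
apply/continuousP => U oU; rewrite realization_openE => A _ u uA Uu.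
have := open_nbhs_nbhs (conj oU Uu); rewrite -nbhs_ballE => -[e /= e0 eU].
have n0 : 0 < #|` A|.+1%:R :> R by rewrite ltr0n.
exists (e / #|` A|.+1%:R) => [|v vA uv]; first by rewrite divr_gt0.
apply: eU; rewrite -ball_normE /=.
rewrite (realization_sumE _ uA) (realization_sumE _ vA) -sumrB.
apply: le_lt_trans (ler_norm_sum _ _ _) _.
apply: (@le_lt_trans _ _ (\sum_(p <- A) e / #|` A|.+1%:R)).
  rewrite big_mkcond big_seq [leRHS]big_seq; apply: ler_sum => p pA.
  by case: ifP => _; [exact/ltW/uv|rewrite divr_ge0 ?ltW].
rewrite big_const_seq count_predT iter_addr_0.
by rewrite -mulrnAl ltr_pdivrMr// -[X in X < _]mulr_natr ltr_pM2l// ltr_nat.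
Qed.

Lemma mass_pred1 (w : space) p : \sum_(q <- finsupp w | q == p) w q = w p.
Proof.
rewrite big_mkcond; case: (boolP (p \in finsupp w)) => pw.
  by rewrite (bigD1_seq p) ?fset_uniq//= eqxx big1 ?addr0// => q /negPf->.
rewrite fsfun_dflt// big_seq big1// => q qw.
by case: eqP => // qp; rewrite -qp qw in pw.
Qed.

Lemma continuous_coord p : continuous (fun w : space => w p : R).
Proof.
under eq_fun do rewrite -mass_pred1.
exact: continuous_mass.
Qed.

Lemma near_coords (T : Type) (F : set_system T) (FF : Filter F)
    (E : T -> space) (l : space) (A : {fset P}) (e : R) : 0 < e ->
  (forall p, E z p @[z --> F] --> l p) ->
  \forall z \near F, forall p, p \in A -> `|l p - E z p| < e.
Proof.
move=> e0 El.
have : \forall z \near F, forall p : A, `|l (val p) - E z (val p)| < e.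
  apply: filter_forall => p.
  by have /cvgrPdist_lt/(_ _ e0) := El (val p).
by apply: filterS => z zE p pA; exact: (zE [` pA]).
Qed.

Lemma near_finsupp (T : Type) (F : set_system T) (FF : Filter F)
    (E : T -> space) (l : space) :
  (forall p, E z p @[z --> F] --> l p) ->
  \forall z \near F, finsupp l `<=` finsupp (E z).
Proof.
move=> El.
have : \forall z \near F, forall p : finsupp l, E z (val p) != 0.
  apply: filter_forall => p.
  have lp : 0 < l (val p).
    by rewrite lt_neqAle realization_ge0 eq_sym -mem_finsupp (valP p).
  have /cvgrPdist_lt/(_ _ lp) := El (val p).
  apply: filterS => z; apply: contraTneq => ->.
  by rewrite subr0 ger0_norm ?ltxx// ltW.
apply: filterS => z zE; apply/fsubsetP => p pl.
by rewrite mem_finsupp; exact: (zE [` pl]).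
Qed.

(** On the subcomplex spanned by a finite set the weak topology is the topology
of coordinatewise convergence: if the coordinates of [E z] are close to those
of [l], then the support of [E z] contains that of [l] and is one of finitely
many chains, so that finitely many simplices decide whether [E z] is close to
[l]. *)
Lemma cvg_face (T : Type) (F : set_system T) (FF : Filter F)
    (E : T -> space) (l : space) (B : {fset P}) :
  face B l -> (\forall z \near F, face B (E z)) ->
  (forall p, E z p @[z --> F] --> l p) -> E z @[z --> F] --> l.
Proof.
move=> lB EB El U /=; rewrite nbhsE => -[V [oV Vl] VU].
have VE : \forall z \near F, forall C : fpowerset B,
    finsupp l `<=` val C -> chain (val C) -> finsupp (E z) `<=` val C ->
    V (E z).
  apply: filter_forall => C.
  case: (boolP (finsupp l `<=` val C)) => lC; last by apply: nearW.
  case: (boolP (chain (val C))) => cC; last by apply: nearW.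
  have [e e0 eV] := oV _ cC _ lC Vl.
  have := near_coords FF (val C) e0 El; apply: filterS => z zE _ _ zC.
  exact: eV.
have suppE := near_finsupp FF El.
change (\forall z \near F, U (E z)).
near=> z; apply: VU.
have zB : finsupp (E z) \in fpowerset B.
  by rewrite fpowersetE; near: z.
apply: ((near VE z _) [` zB]) => //=.
- by near: z.
- exact: chain_finsupp.
Unshelve. all: end_near. Qed.

Lemma nbhs_face (A : {fset P}) (u : space) (U : set space) : chain A ->
  face A u -> nbhs u U ->
  exists2 e : R, 0 < e & forall v, face A v ->
    (forall p, p \in A -> `|u p - v p| < e) -> U v.
Proof.
move=> cA uA; rewrite nbhsE => -[V [oV Vu] VU].
have [e e0 eV] := oV A cA u uA Vu.
by exists e => // v vA uv; exact/VU/eV.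
Qed.

Lemma open_on_faces (V : set space) :
  (forall A u, chain A -> face A u -> V u ->
     \forall v \near u, face A v -> V v) -> open V.
Proof.
move=> Vnear; rewrite realization_openE => A cA u uA Vu.
have [e e0 eV] := nbhs_face cA uA (Vnear A u cA uA Vu).
by exists e => // v vA uv; exact: eV.
Qed.

Lemma continuous_on_faces (T : topologicalType) (f : space -> T) :
  (forall A, chain A -> {within face A, continuous f}) -> continuous f.
Proof.
move=> fc; apply/continuousP => U oU; apply: open_on_faces => A u cA uA Uu.
have /subspace_continuousP/(_ u uA) := fc A cA.
by move=> /(_ U (open_nbhs_nbhs (conj oU Uu))).
Qed.

(** A finite complex has the weak topology with respect to its simplices. This
extends continuity from simplices to the finite subcomplexes in which the image
of a simplex lies, as is needed to compose maps. *)
Lemma within_continuous_face (T : topologicalType) (f : space -> T)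
    (B : {fset P}) :
  (forall A, A `<=` B -> chain A -> {within face A, continuous f}) ->
  {within face B, continuous f}.
Proof.
move=> fc; apply/subspace_continuousP => u uB U Uu.
have fE : \forall v \near u, forall C : fpowerset B,
    finsupp u `<=` val C -> chain (val C) -> face (val C) v -> U (f v).
  apply: (filter_forall (nbhs_filter u) (f := fun (C : fpowerset B) v =>
    finsupp u `<=` val C -> chain (val C) -> face (val C) v -> U (f v))) => C.
  case: (boolP (finsupp u `<=` val C)) => uC; last by apply: nearW.
  case: (boolP (chain (val C))) => cC; last by apply: nearW.
  have CB : val C `<=` B by rewrite -fpowersetE (valP C).
  have /subspace_continuousP/(_ u uC) := fc _ CB cC.
  by move=> /(_ U Uu); apply: (@filterS _ _ (nbhs_filter u)) => v vU _ _;
    exact: vU.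
have supp : \forall v \near u, finsupp u `<=` finsupp (v : space).
  apply: (near_finsupp (nbhs_filter u) (E := id)) => p; exact: continuous_coord.
apply: (@filterS2 _ _ (nbhs_filter u) _ _ _ _ supp fE) => v uv vE vB.
have vBp : finsupp v \in fpowerset B by rewrite fpowersetE.
by have /(_ (chain_finsupp v) (fsubset_refl _)) := vE [` vBp] uv.
Qed.

(** The product of a complex with the compact interval again has the weak
topology. Given a neighbourhood [O] of a value at [(u0, s0)], a compact
interval [J] around [s0] is mapped into [O] with [u0]; by the tube lemma on
each simplex, the set [V] of the points that are mapped into [O] with all of
[J] is open. *)
Lemma homotopy_continuous_on_faces (T : topologicalType) (H : space * R -> T) :
  (forall A, chain A ->
     {within [set z | face A z.1 /\ z.2 \in `[0, 1]], continuous H}) ->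
  {within [set z | z.2 \in `[0, 1]], continuous H}.
Proof.
move=> Hc; apply/subspace_continuousP => -[u0 s0] /= s01 U.
rewrite nbhsE => -[O [oO OH] OU].
have Hnear A u s : chain A -> face A u -> s \in `[0, 1] -> O (H (u, s)) ->
    \forall s' \near s & v \near u, face A v -> s' \in `[0, 1] -> O (H (v, s')).
  move=> cA uA sI OHus.
  have /subspace_continuousP/(_ (u, s) (conj uA sI)) := Hc A cA.
  move=> /(_ O (open_nbhs_nbhs (conj oO OHus))) [[V W] /= [Vu Ws] VW].
  exists (W, V) => //= -[s' v] /= [Ws' Vv] vA s'I.
  by apply: (VW (v, s')).
have : \forall s \near s0, s \in `[0, 1] -> O (H (u0, s)).
  have [[W V] /= [Ws Vu] WV] :=
    Hnear (finsupp u0) u0 s0 (chain_finsupp u0) (fsubset_refl _) s01 OH.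
  apply: filterS Ws => s Ws sI.
  apply: (WV (s, u0)) => //=; last exact: fsubset_refl.
  by split => //; exact: nbhs_singleton.
move=> /nbhs_ballP[e /= e0 eO].
(* Half of the radius, so that the closed interval lies in the open ball. *)
pose a := Num.max 0 (s0 - e / 2); pose b := Num.min 1 (s0 + e / 2).
have e20 : 0 < e / 2 by rewrite divr_gt0.
have abP s : s \in `[a, b] = (s \in `[0, 1]) && (`|s0 - s| <= e / 2).
  rewrite !in_itv /= ge_max le_min ler_distlC.
  by case: (0 <= s); case: (s <= 1); case: (s0 - e / 2 <= s);
    rewrite //= ?andbF.
have Kc : compact `[a, b] by exact: segment_compact.
pose V := [set v : space | forall s, s \in `[a, b] -> O (H (v, s))].
have oV : open V.
  apply: open_on_faces => A u cA uA Vu.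
  have := (iffLR (compact_near_coveringP _) Kc) space (nbhs u)
    (fun v s => face A v -> s \in `[0, 1] -> O (H (v, s))) _.
  have step : forall s, [set` `[a, b]] s ->
     \forall s' \near s & v \near u, face A v -> s' \in `[0, 1] ->
       O (H (v, s')).
    move=> s /= sab; apply: Hnear => //; last exact: Vu.
    by move: sab; rewrite abP => /andP[].
  move=> /(_ _ step); apply: filterS => v vO vA s sab.
  by apply: vO => //; move: sab; rewrite abP => /andP[].
have Vu0 : V u0.
  move=> s; rewrite abP => /andP[sI ss0]; apply: eO => //.
  rewrite -ball_normE /=; apply: le_lt_trans ss0 _.
  by rewrite ltr_pdivrMr// ltr_pMr// ltr1n.
exists (V, ball s0 (e / 2)).
  by split; [exact: open_nbhs_nbhs (conj oV Vu0)|exact: nbhsx_ballx].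
move=> [v s] /= [Vv]; rewrite -ball_normE /= => ss sI; apply/OU/Vv.
by rewrite abP sI ltW.
Qed.

End WeakTopology.

(** * The cone homotopy *)

Section RealLimits.
Context (R : realType) (T : Type) (F : set_system T) (FF : Filter F).

Lemma cvg_minr (f g : T -> R) (a b : R) :
  f z @[z --> F] --> a -> g z @[z --> F] --> b ->
  Num.min (f z) (g z) @[z --> F] --> Num.min a b.
Proof.
move=> fa gb; under eq_fun => ? do rewrite minr_absE.
rewrite minr_absE; apply: cvgM; [|exact: cvg_cst].
by apply: cvgB; [exact: cvgD|apply: cvg_norm; exact: cvgB].
Qed.

Lemma cvg_maxr (f g : T -> R) (a b : R) :
  f z @[z --> F] --> a -> g z @[z --> F] --> b ->
  Num.max (f z) (g z) @[z --> F] --> Num.max a b.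
Proof.
move=> fa gb; under eq_fun => ? do rewrite maxr_absE.
rewrite maxr_absE; apply: cvgM; [|exact: cvg_cst].
by apply: cvgD; [exact: cvgD|apply: cvg_norm; exact: cvgB].
Qed.

Lemma cvg_sumr (I : Type) (r : seq I) (Q : pred I) (f : I -> T -> R)
    (a : I -> R) : (forall i, Q i -> f i z @[z --> F] --> a i) ->
  \sum_(i <- r | Q i) f i z @[z --> F] --> \sum_(i <- r | Q i) a i.
Proof. by move=> fa; apply: cvg_big => //; exact: add_continuous. Qed.

End RealLimits.

Section Cone.
Context (R : realType) (d : Order.disp_t) (P : porderType d).
Local Notation space := (realization R P).

Definition mass (w : space) (Q : pred P) : R := \sum_(p <- finsupp w | Q p) w p.

Lemma mass_ge0 w Q : 0 <= mass w Q.
Proof. by apply: sumr_ge0 => p _; exact: realization_ge0. Qed.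

Lemma mass_le w (Q Q' : pred P) : {subset Q <= Q'} -> mass w Q <= mass w Q'.
Proof.
move=> QQ'; rewrite /mass big_mkcond [leRHS]big_mkcond; apply: ler_sum => p _.
case: ifP => [/QQ'|_]; first by rewrite unfold_in => ->.
by case: ifP => // _; exact: realization_ge0.
Qed.

Lemma eq_mass w (Q Q' : pred P) : Q =1 Q' -> mass w Q = mass w Q'.
Proof. exact: eq_bigl. Qed.

Lemma mass_all (w : space) (Q : pred P) :
  {subset finsupp w <= Q} -> mass w Q = 1.
Proof.
have /and3P[_ _ /eqP w1] := baryP w => wQ; rewrite -w1 /mass big_mkcond.
rewrite big_seq [RHS]big_seq; apply: eq_bigr => p pw.
by have := wQ p pw; rewrite unfold_in => ->.
Qed.

Lemma massC (w : space) (Q : pred P) : mass w Q + mass w (predC Q) = 1.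
Proof.
by have /and3P[_ _ /eqP w1] := baryP w; rewrite -w1 [RHS](bigID Q).
Qed.

Variables (L : pred P) (f : P -> P) (c : P).

(** The mass of [w] on [L] is laid out as an interval, in the order of the
chain that supports it; [p] occupies the part from [low w p] to [upto w p]. *)
Definition low (w : space) p := mass w (fun q => L q && (q < p)%O).
Definition upto (w : space) p := mass w (fun q => L q && (q <= p)%O).

(** The length of the part of the interval of [p] below the threshold [tau]. *)
Definition kept (w : space) (tau : R) p : R :=
  if L p then Num.min (upto w p) tau - Num.min (low w p) tau else 0.

(** The mass below the threshold [tau] stays where it is and the mass above it
moves from [p] to [f p]; this is the prism homotopy from the identity to [f] as
[tau] decreases. All of this is scaled by [k], and mass [m] is put at [c]. *)
Definition cone_wt (w : space) (tau k m : R) q : R :=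
  k * (kept w tau q +
       \sum_(p <- finsupp w | L p && (f p == q)) (w p - kept w tau p)) +
  m * (q == c)%:R.

Definition cone_supp (w : space) : {fset P} :=
  finsupp w `|` f @` finsupp w `|` [fset c].

Definition cone_fsfun (w : space) tau k m : {fsfun P -> R with 0} :=
  [fsfun q in cone_supp w => cone_wt w tau k m q].

(** The value [w] is a placeholder for parameters with which the weights are
not barycentric coordinates. *)
Definition cone w tau k m : space := insubd w (cone_fsfun w tau k m).

Lemma upto_low w p : L p -> upto w p = low w p + w p.
Proof.
move=> Lp; rewrite -mass_pred1 /upto /low /mass (bigID (pred1 p)) addrC /=.
congr (_ + _); apply: eq_bigl => q /=.
  by case: eqP => [->|_]; rewrite ?Lp ?lexx ?andbF.
by rewrite lt_neqAle -andbA [_ && (q != p)]andbC.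
Qed.

Lemma upto_le_low w p q : (p < q)%O -> upto w p <= low w q.
Proof.
move=> pq; apply: mass_le => x; rewrite !unfold_in => /andP[-> xp] /=.
exact: le_lt_trans xp pq.
Qed.

Lemma kept_ge0 w tau p : 0 <= kept w tau p.
Proof.
rewrite /kept; case: ifP => // Lp; rewrite subr_ge0.
have := upto_low w Lp; have := realization_ge0 w p.
move=> w0 ->; rewrite le_min ge_min ge_min lexx orbT andbT.
by rewrite lerDl w0.
Qed.

Lemma kept_le (w : space) tau p : kept w tau p <= w p.
Proof.
rewrite /kept; case: ifP => [Lp|_]; last exact: realization_ge0.
rewrite (upto_low w Lp); have w0 := realization_ge0 w p.
by case: (leP (low w p + w p) tau) => ?; case: (leP (low w p) tau) => ?; lra.
Qed.

Lemma kept_supp (w : space) tau p : p \notin finsupp w -> kept w tau p = 0.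
Proof.
move=> pw; apply/eqP; rewrite eq_le kept_ge0 andbT.
by rewrite -[leRHS](fsfun_dflt pw) kept_le.
Qed.

Lemma kept_gt0 (w : space) tau p : kept w tau p != 0 -> L p && (low w p < tau).
Proof.
rewrite /kept; case: ifP => [Lp /=|_]; last by rewrite eqxx.
rewrite (upto_low w Lp); have w0 := realization_ge0 w p.
by apply: contraNT; rewrite -leNgt => tl; apply/eqP;
  case: (leP (low w p + w p) tau) => ?; case: (leP (low w p) tau) => ?; lra.
Qed.

Lemma kept_lt (w : space) tau p :
  L p -> w p - kept w tau p != 0 -> tau < upto w p.
Proof.
move=> Lp; rewrite /kept Lp (upto_low w Lp); have w0 := realization_ge0 w p.
by apply: contraNT; rewrite -leNgt => tl; apply/eqP;
  case: (leP (low w p + w p) tau) => ?; case: (leP (low w p) tau) => ?; lra.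
Qed.

Lemma kept1 (w : space) p : {subset finsupp w <= L} -> kept w 1 p = w p.
Proof.
move=> wL; case: (boolP (p \in finsupp w)) => pw; last first.
  by rewrite kept_supp// fsfun_dflt.
have Lp : L p := wL p pw.
have le1 Q : mass w Q <= 1.
  by rewrite -(@mass_all w predT)//; apply: mass_le.
rewrite /kept Lp !min_l ?le1//; first by rewrite (upto_low w Lp) addrC addKr.
Qed.

Lemma cone_wt_supp w tau k m q :
  q \notin cone_supp w -> cone_wt w tau k m q = 0.
Proof.
rewrite !inE !negb_or -andbA => /and3P[qw qf qc].
rewrite /cone_wt kept_supp// (negbTE qc) mulr0 addr0 add0r.
rewrite big_seq_cond big1 ?mulr0// => p /and3P[pw _ /eqP fp].
by case/negP: qf; rewrite -fp in_imfset.
Qed.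

Lemma cone_fsfunE w tau k m q : cone_fsfun w tau k m q = cone_wt w tau k m q.
Proof. by rewrite fsfun_fun; case: ifPn => // /cone_wt_supp ->. Qed.

(** The last clause lets mass reach [c] only after all the other mass has moved
to the image of [f]: the points [f p] are above [c], but an unmoved [p] need
not be comparable with [c]. *)
Definition cone_ok (w : space) (tau k m : R) :=
  [/\ 0 <= k, 0 <= m, k * mass w L + m = 1 & m = 0 \/ tau = 0].

Hypothesis f_homo : forall p q, L p -> L q -> (p <= q)%O -> (f p <= f q)%O.
Hypothesis f_ge : forall p, L p -> (p <= f p)%O.
Hypothesis c_le : forall p, L p -> (c <= f p)%O.

Lemma cone_wtP (w : space) tau k m q : cone_wt w tau k m q != 0 ->
  [\/ q \in finsupp w /\ kept w tau q != 0,
      exists p, [/\ p \in finsupp w, L p, w p - kept w tau p != 0 & q = f p] |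
      m != 0 /\ q = c].
Proof.
move=> q0; case: (eqVneq (kept w tau q) 0) => [k0|]; last first.
  move=> k0; constructor 1; split=> //; apply: contraNT k0 => /kept_supp ->.
  by rewrite eqxx.
case: (pselect (exists p, [/\ p \in finsupp w, L p, w p - kept w tau p != 0 &
  q = f p])) => [|np]; first by constructor 2.
constructor 3; move: q0; rewrite /cone_wt k0 add0r big_seq_cond big1.
  rewrite mulr0 add0r mulf_eq0 negb_or => /andP[m0 qc]; split=> //.
  by apply/eqP; move: qc; case: (q == c); rewrite ?eqxx.
move=> p /and3P[pw Lp /eqP fp]; apply/eqP/negPn/negP => h.
by apply: np; exists p.
Qed.

(** If [p] keeps some mass and [q] loses some, then [p] starts below the
threshold and [q] ends above it. Hence [p <= q] in the chain, and [p <= q <= f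
q]. *)
Lemma cone_chain w tau k m : cone_ok w tau k m ->
  chain (finsupp (cone_fsfun w tau k m)).
Proof.
move=> [_ _ _ mtau]; have cw := allrelP (chain_finsupp w).
(* If q < p, then the interval of q ends before that of p begins, whereas p
   starts below the threshold and q ends above it. *)
have cmp_kept_moved p q : p \in finsupp w -> kept w tau p != 0 ->
    q \in finsupp w -> L q -> w q - kept w tau q != 0 -> (p <= f q)%O.
  move=> pw /kept_gt0/andP[Lp lp] qw Lq /(kept_lt Lq) uq.
  have /orP[pq|qp] := cw p q pw qw; first exact: le_trans pq (f_ge Lq).
  move: qp; rewrite le_eqVlt => /orP[/eqP->|]; first exact: f_ge.
  move=> /(upto_le_low w); rewrite leNgt.
  by rewrite (lt_trans lp uq).
have cmp_moved p q : p \in finsupp w -> q \in finsupp w -> L p -> L q ->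
    (f p >=< f q)%O.
  move=> pw qw Lp Lq; have /orP[pq|qp] := cw p q pw qw; apply/orP.
    by left; exact: f_homo.
  by right; exact: f_homo.
(* With threshold 0 nothing is kept. *)
have kept_c p : m != 0 -> kept w tau p != 0 -> False.
  case: mtau => -> m0 /kept_gt0 => [|/andP[_]]; first by rewrite eqxx in m0.
  by rewrite ltNge mass_ge0.
apply/allrelP => x y; rewrite !mem_finsupp !cone_fsfunE.
move=> /cone_wtP[[xw kx]|[p [pw Lp kp ->]]|[m0 ->]];
move=> /cone_wtP[[yw ky]|[q [qw Lq kq ->]]|[m0' ->]].
- exact: cw.
- by rewrite /Order.comparable cmp_kept_moved.
- by case: (kept_c x m0').
- by rewrite /Order.comparable cmp_kept_moved// orbT.
- exact: cmp_moved.
- by rewrite /Order.comparable c_le// orbT.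
- by case: (kept_c y m0).
- by rewrite /Order.comparable c_le.
- by rewrite /Order.comparable lexx.
Qed.

(** Moving mass along [f] does not change the total, which is [k] times the
mass on [L] plus the [m] put at [c]. *)
Lemma cone_sum w tau k m :
  \sum_(q <- finsupp (cone_fsfun w tau k m)) cone_fsfun w tau k m q =
  k * mass w L + m.
Proof.
have -> : \sum_(q <- finsupp (cone_fsfun w tau k m)) cone_fsfun w tau k m q =
          \sum_(q <- cone_supp w) cone_fsfun w tau k m q.
  apply: big_fset_incl; first exact: finsupp_sub.
  by move=> q _ /fsfun_dflt->.
under eq_bigr do rewrite cone_fsfunE.
rewrite big_split /= -!big_distrr /=; congr (_ * _ + _); last first.
  rewrite (bigD1_seq c) ?fset_uniq ?inE ?eqxx ?orbT//= big1 ?addr0 ?mulr1//.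
  by move=> q /negPf->.
rewrite big_split /=.
have -> : \sum_(q <- cone_supp w) kept w tau q =
          \sum_(q <- finsupp w | L q) kept w tau q.
  rewrite [RHS]big_mkcond /=; under [RHS]eq_bigr => q _.
    rewrite (_ : (if L q then _ else _) = kept w tau q); last first.
      by rewrite /kept; case: (L q).
    over.
  apply/esym/big_fset_incl; first by rewrite /cone_supp -fsetUA fsubsetUl.
  by move=> q _; exact: kept_supp.
rewrite (exchange_big_dep L) /=; last by move=> ? ? _ /andP[].
rewrite -big_split /=; rewrite /mass big_seq_cond [RHS]big_seq_cond.
apply: eq_bigr => p /andP[pw Lp].
rewrite Lp /= big_mkcond (bigD1_seq (f p)) ?fset_uniq//=; last first.
  by rewrite !inE in_imfset ?orbT.
rewrite eqxx big1 ?addr0; first by rewrite addrC subrK.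
by move=> q /negPf; rewrite eq_sym => ->.
Qed.

Lemma coneE w tau k m q : cone_ok w tau k m ->
  cone w tau k m q = cone_wt w tau k m q.
Proof.
move=> ok; rewrite -cone_fsfunE /cone -[bary _]/(val _) val_insubd ifT//.
have [k0 m0 s1 _] := ok; apply/and3P; split.
- exact: cone_chain.
- apply/allP => p _; rewrite cone_fsfunE addr_ge0 ?mulr_ge0//.
  rewrite addr_ge0 ?kept_ge0//; apply: sumr_ge0 => ? _.
  by rewrite subr_ge0 kept_le.
- by rewrite cone_sum s1.
Qed.

Lemma cone_face (w : space) tau k m (A : {fset P}) : cone_ok w tau k m ->
  finsupp w `<=` A -> face (A `|` f @` A `|` [fset c]) (cone w tau k m).
Proof.
move=> ok wA; apply/fsubsetP => q; rewrite mem_finsupp coneE//.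
apply: contraR => qA; apply/eqP/cone_wt_supp; apply: contra qA.
by apply: fsubsetP; rewrite fsetSU// fsetUSS// imfset_mono.
Qed.

(** The coordinates are finite sums of minima and products of the masses, which
are continuous. *)
Lemma cvg_cone_wt (T : Type) (F : set_system T) (FF : Filter F)
    (W : T -> space) (tau k m : T -> R) w tau0 k0 m0 (A : {fset P}) q :
  face A w -> (\forall z \near F, face A (W z)) ->
  W z @[z --> F] --> w -> tau z @[z --> F] --> tau0 ->
  k z @[z --> F] --> k0 -> m z @[z --> F] --> m0 ->
  cone_wt (W z) (tau z) (k z) (m z) q @[z --> F] --> cone_wt w tau0 k0 m0 q.
Proof.
move=> wA WA Ww ttau kk mm.
have cmass Q : mass (W z) Q @[z --> F] --> mass w Q.
  exact: (continuous_cvg _ (@continuous_mass _ _ _ Q w) Ww).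
have ckept p : kept (W z) (tau z) p @[z --> F] --> kept w tau0 p.
  rewrite /kept; case: ifP => _; last exact: cvg_cst.
  by apply: cvgB; apply: cvg_minr => //; exact: cmass.
apply: cvgD; last by apply: cvgM => //; exact: cvg_cst.
apply: cvgM => //; apply: cvgD => //.
have sumE v t : face A v -> \sum_(p <- finsupp v | L p && (f p == q))
    (v p - kept v t p) = \sum_(p <- A | L p && (f p == q)) (v p - kept v t p).
  move=> vA; rewrite big_mkcond [RHS]big_mkcond; apply: big_fset_incl => //.
  by move=> p _ pv; rewrite kept_supp// fsfun_dflt// subrr if_same.
rewrite (sumE _ _ wA); apply: (@cvg_trans _
  (\sum_(p <- A | L p && (f p == q)) (W z p - kept (W z) (tau z) p)
     @[z --> F])).
  apply: near_eq_cvg; apply: filterS WA => z zA; exact/esym/sumE.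
apply: cvg_sumr => p _; apply: cvgB => //.
exact: (continuous_cvg _ (@continuous_coord _ _ _ p w) Ww).
Qed.

End Cone.

(** * Group actions and conical contractions *)

Section Actions.
Context (G : groupType).

Lemma act_inv (T : Type) (b : gact G T) g x : b g (b g^-1%g x) = x.
Proof. by rewrite -actM mulgV act1. Qed.

Lemma inv_act (T : Type) (b : gact G T) g x : b g^-1%g (b g x) = x.
Proof. by rewrite -actM mulVg act1. Qed.

Lemma act_inj (T : Type) (b : gact G T) g : injective (b g).
Proof. exact: can_inj (inv_act b g). Qed.

Context (R : realType) (d : Order.disp_t) (P : porderType d).
Context (a : gact G P) (a_mono : monotone_act a).
Local Notation space := (realization R P).
Local Notation ract := (realization_act R a_mono).

Lemma act_le g p q : (a g p <= a g q)%O = (p <= q)%O.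
Proof.
apply/idP/idP => [/(a_mono g^-1%g)|/(a_mono g)//].
by rewrite !inv_act.
Qed.

Lemma act_lt g p q : (a g p < a g q)%O = (p < q)%O.
Proof. by rewrite !lt_neqAle act_le (inj_eq (@act_inj _ a g)). Qed.

Lemma coord_act g (w : space) p : ract g w (a g p) = w p.
Proof.
rewrite rmapE -[RHS]mass_pred1; apply: eq_bigl => q.
exact: inj_eq (@act_inj _ a g) q p.
Qed.

Lemma finsupp_act g (w : space) : finsupp (ract g w) = a g @` finsupp w.
Proof.
apply/fsetP => p; rewrite -[p](act_inv a g) mem_finsupp coord_act.
by rewrite -mem_finsupp mem_imfset//; exact: act_inj.
Qed.

Lemma sum_act g (w : space) (Q : pred P) (F : P -> R) :
  \sum_(q <- finsupp (ract g w) | Q q) F q =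
  \sum_(p <- finsupp w | Q (a g p)) F (a g p).
Proof.
rewrite finsupp_act big_mkcond big_imfset /=; last first.
  by move=> p q _ _; exact: act_inj.
by rewrite -big_mkcond.
Qed.

Lemma realization_eq_act g (u v : space) :
  (forall p, u (a g p) = v (a g p)) -> u = v.
Proof. by move=> uv; apply: realizationP => p; rewrite -[p](act_inv a g). Qed.

Lemma mass_act g (w : space) (Q : pred P) :
  mass (ract g w) Q = mass w (fun p => Q (a g p)).
Proof.
by rewrite /mass sum_act; apply: eq_bigr => p _; rewrite coord_act.
Qed.

(** The construction is natural: an order automorphism that carries the data
[L], [f], [c] to [L'], [f'], [a g c] carries cones to cones. *)
Lemma cone_wt_act (L L' : pred P) (f f' : P -> P) (c : P) g (w : space) tau k m
    q : (forall p, L' (a g p) = L p) ->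
  (forall p, L p -> f' (a g p) = a g (f p)) ->
  cone_wt L' f' (a g c) (ract g w) tau k m (a g q) = cone_wt L f c w tau k m q.
Proof.
move=> LE fE.
have keptE p : kept L' (ract g w) tau (a g p) = kept L w tau p.
  rewrite /kept LE /upto /low !mass_act; case: (L p) => //.
  by congr (Num.min _ _ - Num.min _ _); apply: eq_mass => x;
    rewrite LE ?act_le ?act_lt.
rewrite /cone_wt keptE (inj_eq (@act_inj _ a g)) sum_act.
congr (_ * (_ + _) + _).
apply: eq_big => [p|p _]; last by rewrite keptE coord_act.
rewrite LE; case: (boolP (L p)) => //= Lp.
by rewrite fE// (inj_eq (@act_inj _ a g)).
Qed.

End Actions.

Section Vertex.
Context (R : realType) (d : Order.disp_t) (P : porderType d) (c : P).

Definition vertex_fsfun : {fsfun P -> R with 0} := [fsfun q in [fset c] => 1].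

Lemma vertex_fsfunE q : vertex_fsfun q = (q == c)%:R.
Proof. by rewrite fsfun_fun inE; case: (q == c). Qed.

Lemma vertex_subproof : barycentric vertex_fsfun.
Proof.
have supp : finsupp vertex_fsfun = [fset c].
  apply/fsetP => q; rewrite mem_finsupp vertex_fsfunE inE.
  by case: (q == c); rewrite ?oner_eq0 ?eqxx.
apply/and3P; rewrite supp; split.
- by apply/allrelP => x y; rewrite !inE => /eqP -> /eqP ->; exact: comparablexx.
- by apply/allP => q _; rewrite vertex_fsfunE ler0n.
- by rewrite big_seq_fset1 vertex_fsfunE eqxx.
Qed.

Definition vertex : realization R P := Realization vertex_subproof.

Lemma vertexE q : vertex q = (q == c)%:R.
Proof. exact: vertex_fsfunE. Qed.

End Vertex.

Section ConicalContraction.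
Context (R : realType) (d : Order.disp_t) (P : porderType d) (G : groupType).
Context (a : gact G P) (a_mono : monotone_act a) (f : P -> P) (c : P).
Hypothesis f_homo : {homo f : p q / (p <= q)%O}.
Hypothesis f_ge : forall p, (p <= f p)%O.
Hypothesis c_le : forall p, (c <= f p)%O.
Hypothesis f_act : forall g p, f (a g p) = a g (f p).
Hypothesis c_fix : forall g, a g c = c.

Local Notation tau s := (Num.max 0 (2 * s - 1) : R).
Local Notation m s := (Num.max 0 (1 - 2 * s) : R).
Let H (z : realization R P * R) : realization R P :=
  cone xpredT f c z.1 (tau z.2) (1 - m z.2) (m z.2).

Let H_ok (w : realization R P) (s : R) : s \in `[0, 1] ->
  cone_ok xpredT w (tau s) (1 - m s) (m s).
Proof.
rewrite in_itv /= => /andP[s0 s1]; split.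
- by case: (leP 0 (1 - 2 * s)) => ?; lra.
- by rewrite le_max lexx.
- by rewrite mass_all// mulr1 subrK.
- case: (leP 0 (1 - 2 * s)) => [?|?]; last by left.
  by right; rewrite max_l//; lra.
Qed.

Let HE w s q : s \in `[0, 1] ->
  H (w, s) q = cone_wt xpredT f c w (tau s) (1 - m s) (m s) q.
Proof.
by move=> sI; rewrite /H coneE//; [move=> *; exact: f_homo|exact: H_ok].
Qed.

Let H_face (A : {fset P}) w s : s \in `[0, 1] -> face A w ->
  face (A `|` f @` A `|` [fset c]) (H (w, s)).
Proof.
by move=> sI wA; apply: cone_face => //; [move=> *; exact: f_homo|exact: H_ok].
Qed.

Let H0 w : H (w, 0) = vertex R c.
Proof.
apply: realizationP => q; rewrite HE ?in_itv/= ?lexx ?ler01// vertexE.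
rewrite /cone_wt mulr0 subr0 [X in 1 - X]max_r// subrr mul0r add0r.
by rewrite max_r// mul1r.
Qed.

Let H1 w : H (w, 1) = w.
Proof.
apply: realizationP => q; rewrite HE ?in_itv/= ?lexx ?ler01//.
have -> : m 1 = 0 by rewrite max_l//; lra.
have -> : tau 1 = 1 by rewrite max_r//; lra.
rewrite /cone_wt mul0r addr0 subr0 mul1r kept1// big1 ?addr0// => p _.
by rewrite kept1// subrr.
Qed.

Let H_equiv s : s \in `[0, 1] ->
  equivariant (realization_act R a_mono) (realization_act R a_mono)
    (fun w => H (w, s)).
Proof.
move=> sI g w; apply: (@realization_eq_act _ _ _ _ a g) => p.
rewrite HE// coord_act HE// -{1}(c_fix g).
by rewrite (@cone_wt_act _ _ _ _ _ _ xpredT _ f).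
Qed.

Let H_continuous : {within [set z | z.2 \in `[0, 1]], continuous H}.
Proof.
apply: homotopy_continuous_on_faces => A cA.
apply/subspace_continuousP => -[u s] [/= uA sI].
set D := [set z : realization R P * R | _].
pose F := within D (nbhs (u, s)).
have FD : \forall z \near F, D z by exact: withinT.
have cu : z.1 @[z --> F] --> u by apply: cvg_within_filter; exact: cvg_fst.
have cs : z.2 @[z --> F] --> s by apply: cvg_within_filter; exact: cvg_snd.
apply: (@cvg_face _ _ _ _ F _ H _ (A `|` f @` A `|` [fset c])).
- exact: H_face.
- by apply: filterS FD => -[v r] [/= vA rI]; exact: H_face.
have ctau : tau z.2 @[z --> F] --> tau s.
  by apply: cvg_maxr; [exact: cvg_cst|apply: cvgB; [apply: cvgM => //|];
    exact: cvg_cst].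
have cm : m z.2 @[z --> F] --> m s.
  by apply: cvg_maxr; [exact: cvg_cst|apply: cvgB; [|apply: cvgM => //];
    exact: cvg_cst].
move=> p; rewrite HE//; apply: (@cvg_trans _
  (cone_wt xpredT f c z.1 (tau z.2) (1 - m z.2) (m z.2) p @[z --> F])).
  by apply: near_eq_cvg; apply: filterS FD => -[v r] [/= vA rI]; rewrite HE.
apply: (@cvg_cone_wt _ _ _ _ _ _ _ F _ _ _ _ _ u _ _ _ A) => //.
- by apply: filterS FD => -[v r] [].
- by apply: cvgB => //; exact: cvg_cst.
Qed.

(** The homotopy runs from the constant map at [c], where all mass is at [c],
to the identity, where the threshold is 1. The threshold is 0 during the first
half and no mass is at [c] during the second half, as [cone_ok] demands. *)
Lemma conical_contractible : G_contractible R (realization_act R a_mono).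
Proof.
exists (fun=> tt), (fun=> vertex R c); split.
- by split; [exact: cst_continuous|].
- split; first exact: cst_continuous.
  move=> g _; apply: (@realization_eq_act _ _ _ _ a g) => p.
  by rewrite coord_act !vertexE -{1}(c_fix g) (inj_eq (@act_inj _ _ a g)).
- by exists H.
- exists (fun=> tt); split => //.
  + by apply: continuous_subspaceT; exact: cst_continuous.
  + by case.
Qed.

End ConicalContraction.

(** * The descending link as a poset *)

Section Diameter.
Context (R : realType) (X : metricType R).
Implicit Types S T : Pfn X.

Let dists (S : {fset X}) : set R :=
  [set mdist x y | x in [set` S] & y in [set` S]].

Lemma dists_ubound (S : {fset X}) : has_ubound (dists S).
Proof.
exists (\sum_(x <- S) \sum_(y <- S) mdist x y) => _ [x xS [y yS <-]].
rewrite (bigD1_seq x) ?fset_uniq//= (bigD1_seq y) ?fset_uniq//= -addrA lerDl.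
by rewrite addr_ge0//; do ?[apply: sumr_ge0 => ? _]; exact: mdist_ge0.
Qed.

Lemma mdist_le_diam (S : {fset X}) x y :
  x \in S -> y \in S -> mdist x y <= diam S.
Proof.
move=> xS yS; apply: (ub_le_sup (dists_ubound S)).
by exists x => //; exists y.
Qed.

Lemma diam_le_mono S T : (S <= T)%O -> diam S <= diam T.
Proof.
move=> /fsubsetP ST; have /fset0Pn[x xS] := PfnP S.
apply: ge_sup; first by exists (mdist x x); exists x => //; exists x.
by move=> _ [y /ST yT [z /ST zT <-]]; exact: mdist_le_diam.
Qed.

Lemma morse_ltP S T : reflect
  (diam S < diam T \/ diam S = diam T /\ (#|` T| < #|` S|)%N)
  (morse S < morse T)%O.
Proof.
rewrite ltEprodlexi /= ltrN2 ltz_nat; apply: (iffP andP).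
  move=> [le_ST /implyP ST]; case: (ltgtP (diam S) (diam T)) => [|TS|ST'].
  - by left.
  - by move: le_ST; rewrite leNgt TS.
  - by right; split=> //; apply: ST; rewrite ST'.
move=> [ST|[-> cST]]; last by rewrite lexx.
by rewrite ltW//; split=> //; apply/implyP; rewrite leNgt ST.
Qed.

(** Diameter is monotone, so a subset of [S] of the same diameter or a superset
of larger diameter is never below [S]. *)
Lemma link_predP S T : reflect
  ((T <= S)%O /\ diam T < diam S \/ (S < T)%O /\ diam T = diam S)
  (link_pred S T).
Proof.
apply: (iffP and3P) => [[TS cTS /morse_ltP mTS]|].
  case/orP: cTS => [le_TS|le_ST].
    left; split=> //; case: mTS => // -[_]; rewrite ltnNge.
    by rewrite fsubset_leq_card.
  right; split; first by rewrite lt_neqAle eq_sym TS.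
  by case: mTS => [|[]//]; rewrite ltNge (diam_le_mono le_ST).
move=> [[TS dTS]|[ST dTS]]; split.
- by apply: contraTneq dTS => ->; rewrite ltxx.
- by rewrite /Order.comparable TS.
- by apply/morse_ltP; left.
- by rewrite gt_eqF.
- by rewrite /Order.comparable (ltW ST) orbT.
- apply/morse_ltP; right; split=> //; apply: fproper_ltn_card.
  by rewrite fproperEneq -[_ `<=` _]/(S <= T)%O ltW// andbT;
    apply: contraTneq ST => /val_inj ->; rewrite ltxx.
Qed.

Lemma Pfn_join_subproof S T : Pfn_val S `|` Pfn_val T != fset0.
Proof.
by have /fset0Pn[x xS] := PfnP S; apply/fset0Pn; exists x; rewrite inE xS.
Qed.

Definition Pfn_join S T : Pfn X := MkPfn (Pfn_join_subproof S T).

Lemma Pfn_le_joinl S T : (S <= Pfn_join S T)%O.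
Proof. exact: fsubsetUl. Qed.

Lemma Pfn_le_joinr S T : (T <= Pfn_join S T)%O.
Proof. exact: fsubsetUr. Qed.

Lemma Pfn_join_le S T V : (Pfn_join S T <= V)%O = (S <= V)%O && (T <= V)%O.
Proof. exact: fsubUset. Qed.

Lemma Pfn_join_homo C S T : (S <= T)%O -> (Pfn_join S C <= Pfn_join T C)%O.
Proof. by move=> ST; apply: fsetSU. Qed.

Lemma Pfn_join_idl S T : (T <= S)%O -> Pfn_join S T = S.
Proof. by move=> TS; apply/val_inj/fsetUidPl. Qed.

Lemma Pfn_join_act (G : groupType) (a : gact G X) g S T :
  Pfn_act a g (Pfn_join S T) = Pfn_join (Pfn_act a g S) (Pfn_act a g T).
Proof. by apply: val_inj; rewrite /= imfsetU. Qed.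

End Diameter.

Section Apex.
Context (R : realType) (X : metricType R) (zeta : Pfn X -> Pfn X).

(** The cone point of the descending link. *)
Definition apex (S : Pfn X) : Pfn X :=
  if zeta S `<=` S then zeta S else Pfn_join S (zeta S).

Lemma apex_act (G : groupType) (a : gact G X) :
  equivariant (Pfn_act a) (Pfn_act a) zeta ->
  equivariant (Pfn_act a) (Pfn_act a) apex.
Proof.
move=> zeta_equiv g S; rewrite /apex zeta_equiv -Pfn_join_act.
have -> : (Pfn_act a g (zeta S) `<=` Pfn_act a g S) = (zeta S `<=` S).
  exact: (act_le (Pfn_act_mono a)).
by case: ifP.
Qed.

Context (S : Pfn X).
Hypothesis zeta_in : zeta S `<=` S ->
  diam (zeta S) < diam S /\
  forall S' : Pfn X, S' `<=` S -> diam S' < diam S ->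
    diam (S' `|` zeta S) < diam S.
Hypothesis zeta_out : ~ (zeta S `<=` S) ->
  forall S' : Pfn X, S `<=` S' -> diam S' = diam S ->
    diam (S' `|` zeta S) = diam S.

Lemma link_apex : link_pred S (apex S).
Proof.
rewrite /apex; apply/link_predP; case: ifPn => zS.
  by left; split=> //; have [] := zeta_in zS.
right; split; last by apply: zeta_out => //; exact/negP.
rewrite lt_neqAle Pfn_le_joinl andbT; apply: contraNneq zS => {2}->.
exact: Pfn_le_joinr.
Qed.

(** A lower [T] stays lower by [zeta_in] if the apex is lower, and joins to the
apex itself if the apex is an upper element. An upper [T] absorbs a lower apex
and stays upper by [zeta_out] otherwise. *)
Lemma link_join T : link_pred S T -> link_pred S (Pfn_join T (apex S)).
Proof.
have /link_predP la := link_apex.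
move=> /[dup] lT /link_predP[[TS dTS]|[ST dTS]].
  case: la => [[aS _]|[Sa da]].
    move: aS; rewrite /apex; case: ifPn => zS aS; last first.
      by move: aS; rewrite Pfn_join_le => /andP[_ h]; rewrite [_ `<=` _]h in zS.
    apply/link_predP; left; rewrite Pfn_join_le TS; split=> //.
    by have [_] := zeta_in zS; apply.
  apply/link_predP; right.
  have -> : Pfn_join T (apex S) = apex S.
    apply/val_inj/fsetUidPr; apply: fsubset_trans TS _.
    exact: (ltW Sa : (S <= apex S)%O).
  by [].
apply/link_predP; right; split; first exact: lt_le_trans ST (Pfn_le_joinl _ _).
case: la => [[aS _]|[Sa _]].
  by rewrite Pfn_join_idl// (le_trans aS (ltW ST)).
move: Sa; rewrite /apex; case: ifPn => zS Sa.
  by have := lt_le_trans Sa (zS : (zeta S <= S)%O); rewrite ltxx.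
rewrite [diam _](_ : _ = diam (T `|` zeta S)).
  by apply: zeta_out => //; [exact/negP|exact: (ltW ST : (S <= T)%O)].
congr diam; rewrite /= fsetUA; congr (_ `|` _); apply/fsetUidPl.
exact: (ltW ST : (S <= T)%O).
Qed.

End Apex.

(** * Contractibility of the descending link *)

Section DescendingLink.
Context (R : realType) (X : metricType R) (G : groupType) (a : gact G X).
Context (a_iso : isometric_act a) (zeta : Pfn X -> Pfn X) (S : Pfn X).
Hypothesis zeta_equiv : equivariant (Pfn_act a) (Pfn_act a) zeta.
Hypothesis zeta_in : zeta S `<=` S ->
  diam (zeta S) < diam S /\
  forall S' : Pfn X, S' `<=` S -> diam S' < diam S ->
    diam (S' `|` zeta S) < diam S.
Hypothesis zeta_out : ~ (zeta S `<=` S) ->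
  forall S' : Pfn X, S `<=` S' -> diam S' = diam S ->
    diam (S' `|` zeta S) = diam S.

Let cone_point : subposet (link_pred S) :=
  Subposet (link_apex zeta_in zeta_out).

Let push (T : subposet (link_pred S)) : subposet (link_pred S) :=
  Subposet (link_join zeta_in zeta_out (subposetP T)).

Lemma link_contractible : G_contractible R (lk_act a_iso S).
Proof.
apply: (@conical_contractible _ _ _ _ _ _ push cone_point).
- by move=> T U TU; apply: (Pfn_join_homo (apex zeta S) TU).
- by move=> T; apply: (Pfn_le_joinl (val T)).
- by move=> T; apply: (Pfn_le_joinr (val T)).
- move=> g T; apply: val_inj; apply: esym.
  rewrite [LHS](Pfn_join_act a (val g) (val T) (apex zeta S)).
  by rewrite -(apex_act zeta_equiv) (eqP (stab_valP g)).
- move=> g; apply: val_inj; rewrite [LHS](esym (apex_act zeta_equiv (val g) S)).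
  by rewrite (eqP (stab_valP g)).
Qed.

End DescendingLink.

(** * The rank of a finite subset *)

Section Rank.
Context (R : realType) (X : metricType R) (G : groupType) (a : gact G X).
Context (a_iso : isometric_act a) (a_cocompact : cocompact_act a).
Context (balls_finite : forall (x : X) (r : R), finite_set (ball x r)).

(** Finitely many balls of radius 1 cover [K]. The filter of the finite sets of
centres, ordered by inclusion, turns the covering property of [K] into one
finite set of centres. *)
Lemma compact_finite (K : set X) : compact K -> finite_set K.
Proof.
move=> /compact_near_coveringP Knear.
pose F : set_system {fset X} := fun U => exists A0, forall A, A0 `<=` A -> U A.
have FF : Filter F.
  split.
  - by exists fset0.
  - move=> U V [A AU] [B BV]; exists (A `|` B) => C.
    by rewrite fsubUset => /andP[AC BC]; split; [exact: AU|exact: BV].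
  - by move=> U V UV [A AU]; exists A => B /AU /UV.
(* The parameter of the covering is the finite set of centres. *)
have [x _|A AK] := Knear _ F (fun A x => exists2 y, y \in A & ball y 1 x) FF.
  exists (ball x 1, (fun A : {fset X} => (x \in A) : Prop)).
    split; first exact: nbhsx_ballx.
    by exists [fset x] => A; rewrite fsub1set.
  by move=> [y A] /= [xy xA]; exists x.
apply: (@sub_finite_set _ _ (\bigcup_(y in [set` A]) ball y (1 : R))).
  by move=> x /(AK A (fsubset_refl _)) [y yA xy]; exists y.
by apply: bigcup_finite => //; exact: finite_fset.
Qed.

(** The Morse value is G-invariant, so only sets that meet a finite set [K]
with [X = G K] matter; those of diameter at most [r] lie in the finitely many
balls of radius [r + 1] around [K]. *)
Lemma finite_morse (r : R) :
  finite_set [set morse T | T in [set T : Pfn X | diam T <= r]].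
Proof.
have [K cK KX] := a_cocompact.
have fin_near : finite_set (\bigcup_(y in K) ball y (r + 1)).
  by apply: bigcup_finite => //; exact: compact_finite.
set B := fset_set (\bigcup_(y in K) ball y (r + 1)).
pose morse_fset (A : {fset X}) : R *l int := (diam A, - (#|` A|)%:Z).
apply: (@sub_finite_set _ _ [set morse_fset A | A in [set` fpowerset B]]).
  2: exact/finite_image/finite_fset.
move=> _ [T /= dT <-]; have /fset0Pn[x xT] := PfnP T.
have [g [y [Ky xgy]]] := KX x.
pose T' := Pfn_act a g^-1%g T.
have yT' : y \in Pfn_val T'.
  by apply/imfsetP; exists x => //; rewrite xgy inv_act.
exists (Pfn_val T'); last by rewrite -(morse_act a_iso g^-1%g).
(* Balls are open, hence the radius r + 1 for distances at most r. *)
rewrite /= fpowersetE; apply/fsubsetP => z zT'.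
rewrite in_fset_set// inE; exists y => //; rewrite ballEmdist /=.
apply: (@le_lt_trans _ _ r); last by rewrite ltrDl.
by apply: le_trans dT; rewrite -(diam_act a_iso g^-1%g); exact: mdist_le_diam.
Qed.

Context (t : R).

Definition levels (S : Pfn X) : set (R *l int) :=
  [set morse T | T in [set T : Pfn X | t < diam T /\ (morse T <= morse S)%O]].

(** The position of [morse S] among the Morse values of diameter above [t]. *)
Definition rank (S : Pfn X) : nat := #|` fset_set (levels S)|.

Lemma morse_le_diam (S T : Pfn X) : (morse T <= morse S)%O -> diam T <= diam S.
Proof. by rewrite leEprodlexi => /andP[]. Qed.

Lemma finite_levels S : finite_set (levels S).
Proof.
apply: sub_finite_set (finite_morse (diam S)).
by move=> _ [T [_ /morse_le_diam ?] <-]; exists T.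
Qed.

Lemma rank_eq0 (S : Pfn X) : (rank S == 0)%N = (diam S <= t).
Proof.
apply/idP/idP => [|St].
  rewrite cardfs_eq0; apply: contraTT; rewrite -ltNge => tS.
  apply/fset0Pn; exists (morse S).
  rewrite in_fset_set; last exact: finite_levels.
  by rewrite inE; exists S.
rewrite cardfs_eq0; apply/eqP/fsetP => u; rewrite inE.
apply/negbTE; rewrite in_fset_set; last exact: finite_levels.
apply/negP => /set_mem [T [tT /morse_le_diam TS] _].
by move: (lt_le_trans tT (le_trans TS St)); rewrite ltxx.
Qed.

Lemma rank_lt (S T : Pfn X) : t < diam T -> (morse S < morse T)%O ->
  (rank S < rank T)%N.
Proof.
move=> tT ST; apply: fproper_ltn_card; rewrite fproperE.
have fS := finite_levels S; have fT := finite_levels T; apply/andP; split.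
  rewrite -fset_set_sub// => _ [V [tV VS] <-]; exists V => //; split=> //.
  exact: le_trans VS (ltW ST).
apply/negP; rewrite -fset_set_sub// => /(_ (morse T)) []; first by exists T.
by move=> V [_ VS] VT; move: VS; rewrite VT leNgt ST.
Qed.

Lemma rank_act g S : rank (Pfn_act a g S) = rank S.
Proof. by rewrite /rank /levels morse_act. Qed.

(** Distinct comparable sets have distinct Morse values, and the rank
determines the order of the Morse values above [t]. *)
Lemma link_of_rank (S T : Pfn X) : t < diam S -> (rank T <= rank S)%N ->
  T != S -> (T >=< S)%O -> link_pred S T.
Proof.
move=> tS TS neTS cTS; rewrite /link_pred neTS cTS /=.
have mTS : morse T != morse S.
  apply: contraNneq neTS => -[dTS /oppr_inj [cardTS]]; apply/eqP/val_inj.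
  case/orP: cTS => sTS; [|apply: esym]; apply/eqP;
    rewrite eqEfcard cardTS leqnn andbT; exact: sTS.
case: (ltgtP (morse T) (morse S)) mTS => // ST _.
have := rank_lt (lt_le_trans tS (morse_le_diam (ltW ST))) ST.
by rewrite ltnNge TS.
Qed.

End Rank.

(** * Retraction onto the vertices of rank zero *)

(** The situation in which vertices of positive rank can be removed one rank at
a time: the vertices of smaller or equal rank that are comparable with a vertex
[S] of positive rank span its link [L S], which has the conical contraction [p
<= f S p >= c S]. All data are compatible with the action. *)
Section RankRetraction.
Context (R : realType) (d : Order.disp_t) (P : porderType d) (G : groupType).
Context (a : gact G P) (a_mono : monotone_act a).
Context (rk : P -> nat) (L : P -> pred P) (f : P -> P -> P) (c : P -> P).
Local Notation space := (realization R P).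
Local Notation ract := (realization_act R a_mono).

Hypothesis rk_act : forall g p, rk (a g p) = rk p.
Hypothesis L_act : forall g S p, L (a g S) (a g p) = L S p.
Hypothesis f_act : forall g S p, f (a g S) (a g p) = a g (f S p).
Hypothesis c_act : forall g S, c (a g S) = a g (c S).

Hypothesis L_rk : forall S p, (0 < rk S)%N -> L S p -> (rk p < rk S)%N.
Hypothesis rk_L : forall S p, (0 < rk S)%N -> (rk p <= rk S)%N -> p != S ->
  (p >=< S)%O -> L S p.
Hypothesis f_L : forall S p, (0 < rk S)%N -> L S p -> L S (f S p).
Hypothesis c_L : forall S, (0 < rk S)%N -> L S (c S).
Hypothesis f_homo : forall S p q, (p <= q)%O -> (f S p <= f S q)%O.
Hypothesis f_ge : forall S p, (p <= f S p)%O.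
Hypothesis c_le : forall S p, (c S <= f S p)%O.

Local Notation tau s := (Num.max 0 (1 - 2 * s) : R).
Local Notation k s := ((Num.max (1 - s) (2^-1))^-1 : R).
Local Notation m s := (Num.max 0 (2 * s - 1) : R).

(** A retraction of the cone with apex [S] over the link onto the link. A point
of the cone has height [w S]; at height 0 it is fixed, and with growing height
the rest of the point, rescaled to total mass 1, follows the contraction of the
link. From height 1/2 on the scaling factor is 2 and the mass that is missing
is put at [c S], so that nothing is divided by 0 at the apex. *)
Definition collapse S (w : space) : space :=
  cone (L S) (f S) (c S) w (tau (w S)) (k (w S)) (m (w S)).

(** At most one vertex of the support has rank [n] when all ranks are at most
[n], since comparable vertices of the same positive rank are equal. *)
Definition step (n : nat) (w : space) : space :=
  if ohead [seq S <- finsupp w | rk S == n] is Some T then collapse T w else w.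

Lemma stepP n (w : space) :
  (exists S, [/\ S \in finsupp w, rk S = n & step n w = collapse S w]) \/
  (forall S, S \in finsupp w -> rk S != n) /\ step n w = w.
Proof.
rewrite /step; case E: [seq S <- _ | _] => [|S l] /=; [right|left].
  split=> // S Sw; apply/negP => rS.
  by have := in_nil S; rewrite -E mem_filter rS Sw.
exists S; have := mem_head S l; rewrite -E mem_filter => /andP[/eqP rS Sw].
by split.
Qed.

Lemma coord_le1 (w : space) p : (w : space) p <= 1.
Proof.
rewrite -mass_pred1 -(@mass_all _ _ _ w xpredT)//.
exact: mass_le.
Qed.

Lemma collapse_ok S (w : space) : (0 < rk S)%N ->
  {in finsupp w, forall p, p != S -> L S p} ->
  cone_ok (L S) w (tau (w S)) (k (w S)) (m (w S)).
Proof.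
move=> S0 wL; have LSS : L S S = false.
  by apply/negP => /(L_rk S0); rewrite ltnn.
have -> : cone_ok (L S) w (tau (w S)) (k (w S)) (m (w S)) =
    ([/\ 0 <= k (w S), 0 <= m (w S), k (w S) * (1 - w S) + m (w S) = 1 &
      m (w S) = 0 \/ tau (w S) = 0]).
  rewrite /cone_ok; congr ([/\ _, _, _ * _ + _ = _ & _]).
  rewrite -(massC w (pred1 S)) {2}/mass mass_pred1 addrC addKr.
  rewrite /mass big_seq_cond [RHS]big_seq_cond; apply: eq_bigl => p /=.
  case: (boolP (p \in finsupp w)) => //= pw.
  by case: (eqVneq p S) => [->|/(wL p pw)].
have w0 := realization_ge0 w S; have w1 := coord_le1 w S.
case: (leP (w S) 2^-1) => wS.
  have -> : m (w S) = 0 by rewrite max_l//; lra.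
  have -> : k (w S) = (1 - w S)^-1 by rewrite max_l//; lra.
  split=> //; [|rewrite addr0 mulVf|left] => //; last by apply/eqP; lra.
  by rewrite invr_ge0; lra.
have -> : m (w S) = 2 * w S - 1 by rewrite max_r//; lra.
have -> : k (w S) = 2 by rewrite max_r ?invrK//; lra.
have -> : tau (w S) = 0 by rewrite max_l//; lra.
by split=> //; [lra|lra|right].
Qed.

Lemma collapseE S (w : space) q : (0 < rk S)%N ->
  {in finsupp w, forall p, p != S -> L S p} ->
  collapse S w q =
  cone_wt (L S) (f S) (c S) w (tau (w S)) (k (w S)) (m (w S)) q.
Proof.
move=> S0 wL; rewrite coneE//; last exact: collapse_ok.
by move=> p r _ _; exact: f_homo.
Qed.

Lemma cone_wt_id S (w : space) q : {in finsupp w, forall p, p != S -> L S p} ->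
  S \notin finsupp w ->
  cone_wt (L S) (f S) (c S) w (tau (w S)) (k (w S)) (m (w S)) q = w q.
Proof.
move=> wL Sw; rewrite (fsfun_dflt Sw).
have -> : m 0 = 0 by rewrite max_l//; lra.
have -> : k 0 = 1 by rewrite max_l ?subr0 ?invr1//; lra.
have -> : tau 0 = 1 by rewrite max_r//; lra.
have wL' : {subset finsupp w <= L S}.
  by move=> p pw; apply: wL => //; apply: contraNneq Sw => <-.
rewrite /cone_wt mul0r addr0 mul1r kept1// big1 ?addr0// => p _.
by rewrite kept1// subrr.
Qed.

Lemma chain_link (A : {fset P}) n S : (0 < n)%N -> chain A -> S \in A ->
  rk S = n -> (forall p, p \in A -> (rk p <= n)%N) ->
  {in A, forall p, p != S -> L S p}.
Proof.
move=> n0 /allrelP cA SA rS An p pA pS.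
by apply: rk_L => //; rewrite ?rS//; [exact: An|exact: cA].
Qed.

(** On a simplex with a vertex [S] of rank [n] one formula describes [step n],
also on the opposite face, where [w S = 0] and the map is the identity. *)
Lemma stepE (A : {fset P}) n S (w : space) q : (0 < n)%N -> chain A ->
  S \in A ->
  rk S = n -> (forall p, p \in A -> (rk p <= n)%N) -> face A w ->
  step n w q = cone_wt (L S) (f S) (c S) w (tau (w S)) (k (w S)) (m (w S)) q.
Proof.
move=> n0 cA SA rS An wA; have AL := chain_link n0 cA SA rS An.
have wL : {in finsupp w, forall p, p != S -> L S p}.
  by move=> p /(fsubsetP wA); exact: AL.
have [[S' [S'w rS' ->]]|[nw ->]] := stepP n w; last first.
  rewrite cone_wt_id//; apply/negP => /nw; by rewrite rS eqxx.
suff -> : S' = S by rewrite collapseE ?rS.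
apply/eqP/negPn/negP => /(wL _ S'w) /L_rk.
by rewrite rS rS' ltnn => /(_ n0).
Qed.

Definition step_fset n (A : {fset P}) : {fset P} :=
  [fset q in A `|` [fset f S p | S in A, p in A] `|` c @` A | (rk q < n)%N].

Lemma step_fset_rk n A p : p \in step_fset n A -> (rk p < n)%N.
Proof. by rewrite !inE => /andP[]. Qed.

Lemma step_face n (A : {fset P}) (w : space) : (0 < n)%N ->
  (forall p, p \in A -> (rk p <= n)%N) -> face A w ->
  face (step_fset n A) (step n w).
Proof.
move=> n0 An wA; apply/fsubsetP => q; rewrite mem_finsupp.
have wn p : p \in finsupp w -> (rk p <= n)%N by move=> /(fsubsetP wA)/An.
have [[S [Sw rS ->]]|[nw ->]] := stepP n w; last first.
  rewrite -mem_finsupp => qw; rewrite !inE (fsubsetP wA _ qw) /=.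
  by rewrite ltn_neqAle nw// wn.
have SA := fsubsetP wA _ Sw.
have wL := chain_link n0 (chain_finsupp w) Sw rS wn.
rewrite collapseE ?rS//.
move=> /cone_wtP[[qw /kept_gt0/andP[Lq _]]|[p [pw Lp _ ->]]|[_ ->]].
- by rewrite !inE (fsubsetP wA _ qw) -rS L_rk ?rS.
- rewrite !inE -rS L_rk ?f_L ?rS// andbT; apply/orP; left; apply/orP; right.
  by apply/imfset2P; exists S => //; exists p => //; exact: (fsubsetP wA).
- by rewrite !inE -rS L_rk ?c_L ?rS// in_imfset ?orbT.
Qed.

Lemma within_step n (A : {fset P}) : (0 < n)%N ->
  (forall p, p \in A -> (rk p <= n)%N) -> {within face A, continuous (step n)}.
Proof.
move=> n0 An; apply: within_continuous_face => C /fsubsetP CA cC.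
have Cn p : p \in C -> (rk p <= n)%N by move=> /CA/An.
apply/subspace_continuousP => u uC; pose F := within (face C) (nbhs u).
have FC : \forall v \near F, face C v by exact: withinT.
have cu : id v @[v --> F] --> u by apply: cvg_within_filter; exact: cvg_id.
case: (pselect (exists2 S, S \in C & rk S = n)) => [[S SC rS]|nS]; last first.
  have idC v : face C v -> step n v = v.
    move=> vC; have [[S [Sv rS _]]|[_ ->//]] := stepP n v.
    by case: nS; exists S => //; exact: (fsubsetP vC).
  rewrite /from_subspace (idC _ uC).
  apply: (@cvg_trans _ (id v @[v --> F])) => //.
  by apply: near_eq_cvg; apply: filterS FC => v vC; rewrite /= idC.
apply: (@cvg_face _ _ _ _ F _ _ _ (step_fset n C)).
- exact: step_face.
- by apply: filterS FC => v vC; exact: step_face.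
have cS : (v : space) S @[v --> F] --> u S.
  exact: (continuous_cvg _ (@continuous_coord _ _ _ S u) cu).
have c2S : 2 * (v : space) S @[v --> F] --> 2 * u S.
  by apply: cvgM => //; exact: cvg_cst.
move=> q; rewrite /from_subspace (stepE q n0 cC SC rS Cn uC).
apply: (@cvg_trans _ (cone_wt (L S) (f S) (c S) (v : space)
   (tau (v S)) (k (v S)) (m (v S)) q @[v --> F])).
  apply: near_eq_cvg; apply: filterS FC => v vC.
  by rewrite (stepE q n0 cC SC rS).
apply: (@cvg_cone_wt _ _ _ _ _ _ _ F _ id _ _ _ u _ _ _ C) => //.
- by apply: cvg_maxr; [exact: cvg_cst|apply: cvgB => //; exact: cvg_cst].
- apply: cvgV; first by rewrite gt_eqF// lt_max invr_gt0 ltr0n orbT.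
  by apply: cvg_maxr; [apply: cvgB => //|]; exact: cvg_cst.
- by apply: cvg_maxr; [exact: cvg_cst|apply: cvgB => //; exact: cvg_cst].
Qed.

Lemma step_act n g (w : space) : (0 < n)%N ->
  (forall p, p \in finsupp w -> (rk p <= n)%N) ->
  step n (ract g w) = ract g (step n w).
Proof.
move=> n0 wn; apply: (@realization_eq_act _ _ _ _ a g) => p; rewrite coord_act.
have gwn q : q \in finsupp (ract g w) -> (rk q <= n)%N.
  by rewrite finsupp_act => /imfsetP[x /= xw ->]; rewrite rk_act wn.
have [[S [Sw rS _]]|[nw ->]] := stepP n w; last first.
  have [[S [Sw rS _]]|[_ ->]] := stepP n (ract g w); last by rewrite coord_act.
  move: Sw rS; rewrite finsupp_act => /imfsetP[x /= xw ->].
  by rewrite rk_act => /eqP; rewrite (negPf (nw _ xw)).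
have gSw : a g S \in finsupp (ract g w) by rewrite finsupp_act in_imfset.
have rgS : rk (a g S) = n by rewrite rk_act.
rewrite (stepE p n0 (chain_finsupp w) Sw rS wn (fsubset_refl _)).
rewrite (stepE _ n0 (chain_finsupp _) gSw rgS gwn (fsubset_refl _)).
by rewrite coord_act c_act; apply: cone_wt_act.
Qed.

Fixpoint retr (n : nat) (w : space) : space :=
  if n is n'.+1 then retr n' (step n w) else w.

(** The image of a simplex under one step lies in a finite subcomplex, usually
not in a simplex, so the induction is over finite sets [A] that need not be
chains. *)
Lemma retr_within n (A : {fset P}) : (forall p, p \in A -> (rk p <= n)%N) ->
  {within face A, continuous (retr n)} /\
  exists2 B : {fset P}, forall p, p \in B -> rk p = 0%N &
    forall w, face A w -> face B (retr n w).
Proof.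
elim: n A => [|n IHn] A An.
  split; last by exists A => // p /An; rewrite leqn0 => /eqP.
  by apply: continuous_subspaceT => w; exact: cvg_id.
have sA p : p \in step_fset n.+1 A -> (rk p <= n)%N by move=> /step_fset_rk.
have [rc [B B0 rB]] := IHn _ sA; split; last first.
  by exists B => // w wA; apply/rB/step_face.
apply/subspace_continuousP => u uA.
have suA := step_face (ltn0Sn n) An uA.
move: rc => /subspace_continuousP/(_ _ suA) rc.
have /subspace_continuousP/(_ _ uA) sc := within_step (ltn0Sn n) An.
move=> U /rc; rewrite /nbhs /= => rU.
(* The outer map is continuous only within the finite subcomplex, so the inner
   values have to be known to lie there. *)
have {}sc := sc _ rU.
have FA : \forall v \near within (face A) (nbhs u), face A v by exact: withinT.
apply: filterS2 FA sc => v vA; apply; exact: step_face.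
Qed.

(** The steps of rank above [n] fix the points of rank at most [n], which makes
the infinite composite well defined. *)
Lemma retr_stable n j (w : space) :
  (forall p, p \in finsupp w -> (rk p <= n)%N) ->
  (n <= j)%N -> retr j w = retr n w.
Proof.
move=> wn; elim: j => [|j IHj]; first by rewrite leqn0 => /eqP ->.
rewrite leq_eqVlt => /orP[/eqP->//|nj] /=.
have [[S [Sw rS _]]|[_ ->]] := stepP j.+1 w; last exact: IHj.
by have := wn _ Sw; rewrite rS leqNgt nj.
Qed.

Lemma retr_act n g (w : space) :
  (forall p, p \in finsupp w -> (rk p <= n)%N) ->
  retr n (ract g w) = ract g (retr n w).
Proof.
elim: n w => [//|n IHn] w wn /=; rewrite step_act// IHn// => p.
have := step_face (ltn0Sn n) wn (fsubset_refl _) => /fsubsetP/(_ p) sub /sub.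
exact: step_fset_rk.
Qed.

Definition retraction (w : space) : space :=
  retr (\max_(p <- finsupp w) rk p)%N w.

Lemma rk_le_max (A : {fset P}) p : p \in A -> (rk p <= \max_(q <- A) rk q)%N.
Proof. by move=> pA; apply: leq_bigmax_seq. Qed.

Lemma retractionE (A : {fset P}) (w : space) : face A w ->
  retraction w = retr (\max_(p <- A) rk p)%N w.
Proof.
move=> wA; apply/esym/retr_stable; first exact: rk_le_max.
by apply/bigmax_leqP_seq => p /(fsubsetP wA)/rk_le_max.
Qed.

Lemma retraction_face (A : {fset P}) :
  exists2 B : {fset P}, forall p, p \in B -> rk p = 0%N &
    forall w, face A w -> face B (retraction w).
Proof.
have [_ [B B0 rB]] := retr_within (@rk_le_max A).
by exists B => // w wA; rewrite (retractionE wA); exact: rB.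
Qed.

Lemma continuous_retraction : continuous retraction.
Proof.
apply: continuous_on_faces => A _; have [rc _] := retr_within (@rk_le_max A).
apply: (subspace_eq_continuous _ rc) => w; rewrite inE => wA.
exact/esym/retractionE.
Qed.

(** The rank is invariant, so [w] and its translates pass through the same
number of steps. *)
Lemma retraction_act g (w : space) :
  retraction (ract g w) = ract g (retraction w).
Proof.
rewrite /retraction; set n := (\max_(p <- finsupp w) _)%N.
have <- : n = (\max_(p <- finsupp (ract g w)) rk p)%N.
  rewrite finsupp_act big_imfset /=; last by move=> p q _ _; exact: act_inj.
  by apply: eq_bigr => p _; rewrite rk_act.
by apply: retr_act; exact: rk_le_max.
Qed.

Lemma retraction_id (w : space) : (forall p, p \in finsupp w -> rk p = 0%N) ->
  retraction w = w.
Proof.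
by move=> w0; apply: (@retr_stable 0%N) => // p /w0 ->.
Qed.

End RankRetraction.

(** * The full simplex on X *)

Section Spread.
Context (R : realType) (X : choiceType).
Local Notation space := (realization R (Pfn X)).
Implicit Types (S T : Pfn X) (x y : X).

Lemma card_Pfn_gt0 S : 0 < #|` S|%:R :> R.
Proof. by rewrite ltr0n cardfs_gt0 PfnP. Qed.

Definition density (w : space) (Q : pred (Pfn X)) : R :=
  \sum_(T <- finsupp w | Q T) w T / #|` T|%:R.

(** A vertex [T] is sent to the barycentre of the simplex spanned by its
elements; [spread w] is the resulting point of the full simplex on [X]. *)
Definition spread (w : space) x : R := density w (fun T => x \in Pfn_val T).

Lemma density_term_ge0 (w : space) T : 0 <= w T / #|` T|%:R.
Proof. by rewrite divr_ge0 ?realization_ge0// ltW// card_Pfn_gt0. Qed.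

Lemma density_ge0 w Q : 0 <= density w Q.
Proof. by apply: sumr_ge0 => T _; exact: density_term_ge0. Qed.

Lemma density_le (w : space) (Q Q' : pred (Pfn X)) :
  {in finsupp w, forall T, Q T -> Q' T} -> density w Q <= density w Q'.
Proof.
move=> QQ'; rewrite /density big_mkcond [leRHS]big_mkcond.
rewrite big_seq [leRHS]big_seq; apply: ler_sum => T Tw.
case: ifP => [/(QQ' _ Tw) ->//|_]; case: ifP => // _.
exact: density_term_ge0.
Qed.

Lemma density_le1 w Q : density w Q <= 1.
Proof.
have /and3P[_ _ /eqP <-] := baryP w; rewrite /density big_mkcond.
apply: ler_sum => T _; case: ifP => _; last exact: realization_ge0.
rewrite ler_pdivrMr ?card_Pfn_gt0// ler_peMr ?realization_ge0// ler1n.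
by rewrite cardfs_gt0 PfnP.
Qed.

Lemma density_sumE (w : space) (Q : pred (Pfn X)) (A : {fset Pfn X}) :
  face A w -> density w Q = \sum_(T <- A | Q T) w T / #|` T|%:R.
Proof.
move=> wA; rewrite /density big_mkcond [RHS]big_mkcond.
by apply: big_fset_incl => // T _ /fsfun_dflt ->; rewrite mul0r if_same.
Qed.

Lemma spread_gt0 (w : space) T x : T \in finsupp w -> x \in Pfn_val T ->
  0 < spread w x.
Proof.
move=> Tw xT; rewrite /spread /density big_mkcond.
rewrite (bigD1_seq T) ?fset_uniq//= xT.
rewrite ltr_wpDr//.
  by apply: sumr_ge0 => ? _; case: ifP => // _; exact: density_term_ge0.
by rewrite divr_gt0 ?card_Pfn_gt0// lt_neqAle realization_ge0 eq_sym
  -mem_finsupp Tw.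
Qed.

Lemma spread_out (w : space) (D : {fset X}) x :
  (forall T, T \in finsupp w -> T `<=` D) -> x \notin D -> spread w x = 0.
Proof.
move=> wD xD; rewrite /spread /density big_seq_cond big1// => T.
by case/andP=> /wD /fsubsetP TD /TD; rewrite (negPf xD).
Qed.

Lemma sum_spread (w : space) (D : {fset X}) :
  (forall T, T \in finsupp w -> T `<=` D) -> \sum_(x <- D) spread w x = 1.
Proof.
move=> wD; have /and3P[_ _ /eqP <-] := baryP w.
rewrite /spread /density (exchange_big_dep xpredT)//=.
rewrite big_seq [RHS]big_seq; apply: eq_bigr => T Tw.
have -> : \sum_(x <- D | x \in Pfn_val T) w T / #|` T|%:R =
          \sum_(x <- Pfn_val T) w T / #|` T|%:R.
  rewrite [LHS]big_mkcond /= [RHS]big_seq_cond [RHS]big_mkcond /=.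
  under [RHS]eq_bigr do rewrite andbT.
  apply/esym/big_fset_incl; first exact: wD.
  by move=> x _ /negPf ->.
rewrite big_const_seq count_predT iter_addr_0 -[LHS]mulr_natr.
by apply: divfK; rewrite gt_eqF ?card_Pfn_gt0.
Qed.

(** By induction on the chain: if the element found for the others lies in a
new [T] that does not contain [S], an element of [S] outside [T] works instead.
*)
Lemma chain_avoid (s : seq (Pfn X)) S : all2rel Order.comparable s ->
  exists2 x, x \in Pfn_val S & {in s, forall T, x \in Pfn_val T -> (S <= T)%O}.
Proof.
move=> /allrelP cs.
have {cs}: {in s &, forall T U, (T >=< U)%O} by move=> T U; exact: cs.
elim: s => [|T s IHs] cs; first by have /fset0Pn[x xS] := PfnP S; exists x.
have [|x xS xs] := IHs.
  by move=> U V Us Vs; apply: cs; rewrite inE ?Us ?Vs orbT.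
case: (boolP ((x \in Pfn_val T) && ~~ (S <= T)%O)) => [/andP[xT]|]; last first.
  rewrite negb_and negbK => xT; exists x => // U.
  rewrite inE => /orP[/eqP->|/xs//].
  by move=> xT'; move: xT; rewrite xT'.
move=> /fsubsetPn[y yS yT]; exists y => // U; rewrite inE => /orP[/eqP->|Us].
  by rewrite (negPf yT).
move=> yU; apply: xs => //.
have /orP[/fsubsetP TU|/fsubsetP UT] : (T >=< U)%O.
- by apply: cs; rewrite inE ?eqxx ?Us ?orbT.
- exact: TU.
- by move: yT; rewrite (UT _ yU).
Qed.

(** A smallest member of the chain strictly above [S], if there is one, has an
element outside [S], and this element lies in all members strictly above [S].
*)
Lemma chain_escape (s : seq (Pfn X)) S : all2rel Order.comparable s ->
  {in s, forall T, ~~ (S < T)%O} \/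
  exists y, [/\ y \notin Pfn_val S, exists2 T, T \in s & y \in Pfn_val T &
    {in s, forall T, (S < T)%O -> y \in Pfn_val T}].
Proof.
move=> /allrelP cs.
have {cs}: {in s &, forall T U, (T >=< U)%O} by move=> T U; exact: cs.
elim: s => [|T s IHs] cs; first by left.
have {}IHs := IHs (fun U V Us Vs => cs U V (mem_behead (s := T :: s) Us)
  (mem_behead (s := T :: s) Vs)).
case: (boolP (S < T)%O) => ST; last first.
  case: IHs => [IH|[y [yS [U Us yU] ys]]]; [left|right].
    by move=> U; rewrite inE => /orP[/eqP->//|/IH].
  exists y; split=> //; first by exists U => //; rewrite inE Us orbT.
  by move=> V; rewrite inE => /orP[/eqP->|/ys//]; rewrite (negPf ST).
have /fsubsetPn[z zT zS] : ~~ (T <= S)%O by rewrite -?ltNge lt_geF.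
right; case: IHs => [IH|[y [yS [U Us yU] ys]]].
  exists z; split=> //; first by exists T; rewrite ?mem_head.
  by move=> V; rewrite inE => /orP[/eqP->//|/IH /negPf ->].
case: (boolP (y \in Pfn_val T)) => yT.
  exists y; split=> //; first by exists T; rewrite ?mem_head.
  by move=> V; rewrite inE => /orP[/eqP->//|/ys].
exists z; split=> //; first by exists T; rewrite ?mem_head.
move=> V; rewrite inE => /orP[/eqP->//|Vs SV].
have /orP[/fsubsetP TV|/fsubsetP VT] : (T >=< V)%O.
- by apply: cs; rewrite inE ?eqxx ?Vs ?orbT.
- exact: TV.
- by move: yT; rewrite (VT _ (ys _ Vs SV)).
Qed.

(** The layer-cake formula. The smallest value of [spread w] on [S] is the
total density of the members of the chain that contain [S]; the largest value
outside [S] is that of the members strictly containing [S], provided that [S]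
is in the chain, and at least that in general. So [w] can be read off
continuously from [spread w]. *)
Lemma spreadK (w : space) S (D : {fset X}) :
  (forall T, T \in finsupp w -> T `<=` D) ->
  w S = #|` S|%:R * Num.max 0 (\big[Num.min/1]_(x <- Pfn_val S) spread w x -
    \big[Num.max/0]_(x <- D `\` Pfn_val S) spread w x).
Proof.
move=> wD; set lo := \big[Num.min/1]_(x <- _) _.
set hi := \big[Num.max/0]_(x <- _) _.
pose above := density w (fun T => S <= T)%O.
pose strict := density w (fun T => S < T)%O.
have aboveE : above = strict + w S / #|` S|%:R.
  rewrite /above /density (bigID (pred1 S)) /= addrC; congr (_ + _).
    by apply: eq_bigl => T; rewrite lt_neqAle eq_sym andbC.
  rewrite (eq_bigl (pred1 S)); last first.
    by move=> T /=; case: eqP => [->|_]; rewrite ?lexx ?andbF.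
  case: (boolP (S \in finsupp w)) => Sw.
    by rewrite -big_filter filter_pred1_uniq ?fset_uniq// big_seq1.
  rewrite (fsfun_dflt Sw) mul0r big_seq_cond big1// => T /andP[Tw /eqP TS].
  by rewrite -TS Tw in Sw.
have loE : lo = above.
  (* This x lies in exactly those members of the chain that contain S. *)
  have [x xS xT] := chain_avoid S (chain_finsupp w).
  apply/eqP; rewrite eq_le; apply/andP; split.
    apply: (@le_trans _ _ (spread w x)); first exact: ge_bigmin_seq.
    by apply: density_le => T /xT.
  rewrite /lo big_seq le_bigmin ?density_le1// => y yS.
  by apply: density_le => T _ /fsubsetP; apply.
have hi_ge : strict <= hi.
  (* If no member is strictly above S, then strict is 0, the default of hi. *)
  case: (chain_escape S (chain_finsupp w)) => [nS|[y [yS [T Tw yT] ys]]].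
    rewrite /strict /density big_seq_cond big1.
      by rewrite /hi bigmax_idl le_max lexx.
    by move=> T /andP[/nS /negPf ->].
  apply: (@le_trans _ _ (spread w y)); first exact: density_le.
  apply: le_bigmax_seq => //; rewrite inE yS.
  exact: (fsubsetP (wD _ Tw)).
case: (boolP (S \in finsupp w)) => Sw; last first.
  rewrite (fsfun_dflt Sw) max_l ?mulr0//.
  by rewrite loE aboveE (fsfun_dflt Sw) mul0r addr0 subr_le0.
have hiE : hi = strict.
  apply/eqP; rewrite eq_le hi_ge andbT /hi big_seq.
  rewrite bigmax_le ?density_ge0// => y.
  rewrite inE => /andP[yS _]; apply: density_le => T Tw yT.
  have /orP[] : (S >=< T)%O by exact: (allrelP (chain_finsupp w)).
    by rewrite le_eqVlt => /orP[/eqP ST|//]; rewrite ST yT in yS.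
  by move=> /fsubsetP/(_ _ yT); rewrite (negPf yS).
rewrite loE hiE aboveE addrAC subrr add0r max_r; last exact: density_term_ge0.
by rewrite mulrC divfK// gt_eqF ?card_Pfn_gt0.
Qed.

(** By induction on the support [D]: subtract the minimum of [mu] on [D] from
[mu] on [D]. What remains has smaller support, and [D] is added on top of its
chain. *)
Lemma layer_cake (mu : X -> R) (D : {fset X}) :
  (forall x, x \in D -> 0 < mu x) -> (forall x, x \notin D -> mu x = 0) ->
  exists (A : {fset Pfn X}) (v : Pfn X -> R),
    [/\ chain A, {in A, forall T, T `<=` D}, forall T, 0 <= v T &
        forall x, mu x = \sum_(T <- A | x \in Pfn_val T) v T].
Proof.
move: {2}(#|` D|) (leqnn #|` D|) => n; elim: n mu D => [|n IHn] mu D.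
  rewrite leqn0 cardfs_eq0 => /eqP -> _ mu0.
  exists fset0, (fun=> 0); split=> //.
  by move=> x; rewrite big1// mu0.
case: (eqVneq D fset0) => [-> _ _ mu0|D0 Dn mu_gt0 mu0].
  exists fset0, (fun=> 0); split=> //.
  by move=> x; rewrite big1// mu0.
have /fset0Pn[x1 x1D] := D0.
pose x0 := val [arg min_(x < [` x1D]) mu (val x)]%O.
have x0D : x0 \in D by exact: valP.
have x0_min x : x \in D -> mu x0 <= mu x.
  by move=> xD; rewrite /x0; case: arg_minP => // y _ /(_ [` xD]); exact.
(* The support of what remains after the minimum is subtracted. *)
pose D' := [fset x in D | mu x != mu x0].
pose mu' x := if x \in D then mu x - mu x0 else 0.
have D'D : D' `<=` D by exact: fset_sub.
have x0D' : x0 \notin D' by rewrite !inE eqxx andbF.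
have [|x|x|A [v [cA AD v0 muE]]] := IHn mu' D'.
- rewrite -ltnS; apply: leq_trans Dn; apply: fproper_ltn_card.
  by rewrite fproperE D'D; apply/fsubsetPn; exists x0.
- rewrite !inE /mu' => /andP[xD]; rewrite xD subr_gt0 lt_neqAle eq_sym => ->.
  exact: x0_min.
- rewrite !inE /mu'; case: ifP => //= xD; rewrite negbK => /eqP ->.
  by rewrite subrr.
pose B := MkPfn D0.
have BA : B \notin A.
  by apply/negP => /AD /fsubsetP/(_ x0 x0D); rewrite (negPf x0D').
exists (B |` A), (fun T => if T == B then mu x0 else v T); split.
- apply/allrelP => S T; rewrite !inE => /orP[/eqP->|SA] /orP[/eqP->|TA].
  + exact: comparablexx.
  + by apply/orP; right; exact: (fsubset_trans (AD _ TA) D'D).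
  + by apply/orP; left; exact: (fsubset_trans (AD _ SA) D'D).
  + exact: (allrelP cA).
- move=> T; rewrite !inE => /orP[/eqP->|/AD TD']; first exact: fsubset_refl.
  exact: fsubset_trans TD' D'D.
- by move=> T; case: ifP => // _; exact/ltW/mu_gt0.
move=> x; rewrite big_mkcond big_fsetU1//= eqxx -big_mkcond /=.
have -> : \sum_(T <- A | x \in Pfn_val T) (if T == B then mu x0 else v T) =
    mu' x.
  rewrite muE big_seq_cond [RHS]big_seq_cond; apply: eq_bigr => T /andP[TA _].
  by case: eqP => // TB; rewrite -TB TA in BA.
rewrite /mu'; case: ifP => xD; first by rewrite addrC subrK.
by rewrite mu0 ?xD ?addr0.
Qed.

(** Each level set [T] of the layer-cake decomposition gets the weight [v T]
multiplied by the number of its elements, because a vertex of weight 1 spreads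
to density [1 / #|` T|]. *)
Lemma spread_surj (mu : X -> R) (D : {fset X}) :
  (forall x, 0 <= mu x) -> (forall x, x \notin D -> mu x = 0) ->
  \sum_(x <- D) mu x = 1 -> exists w, spread w =1 mu.
Proof.
move=> mu_ge0 mu0 mu1.
have [x|x|A [v [cA AD v0 muE]]] := @layer_cake mu [fset x in D | mu x != 0].
- by rewrite !inE => /andP[_ mux]; rewrite lt_neqAle eq_sym mux mu_ge0.
- by rewrite !inE negb_and negbK => /orP[/mu0|/eqP].
pose w : {fsfun Pfn X -> R with 0} := [fsfun T in A => v T * #|` T|%:R].
have wE T : T \in A -> w T = v T * #|` T|%:R by rewrite fsfun_fun => ->.
have wA : finsupp w `<=` A by exact: finsupp_sub.
have bw : barycentric w.
  apply/and3P; split.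
  - apply/allrelP => S T /(fsubsetP wA) SA /(fsubsetP wA) TA.
    exact: (allrelP cA).
  - by apply/allP => T /(fsubsetP wA) TA; rewrite wE// mulr_ge0.
  rewrite (_ : \sum_(p <- _) _ = \sum_(T <- A) w T); last first.
    by apply: big_fset_incl => // T _ /fsfun_dflt ->.
  rewrite -mu1; apply/eqP; under [RHS]eq_bigr do rewrite muE.
  rewrite (exchange_big_dep xpredT)//= big_seq [RHS]big_seq.
  apply: eq_bigr => T TA; rewrite wE//.
  have TD : T `<=` D by exact: fsubset_trans (AD _ TA) (fset_sub _ _).
  rewrite [RHS]big_mkcond /= mulr_natr -iter_addr_0 -(count_predT (Pfn_val T)).
  rewrite -big_const_seq big_seq_cond big_mkcond /=.
  under eq_bigr do rewrite andbT.
  by apply: big_fset_incl => // x _ /negPf ->.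
exists (Realization bw) => x; rewrite /spread (@density_sumE _ _ A)// muE.
rewrite big_seq_cond [RHS]big_seq_cond; apply: eq_bigr => T /andP[TA _].
by rewrite /= wE// mulfK// gt_eqF ?card_Pfn_gt0.
Qed.

End Spread.

(** * Straight-line homotopies *)

Section StraightLine.
Context (R : realType) (X : choiceType) (G : groupType) (a : gact G X).
Local Notation space := (realization R (Pfn X)).
Local Notation ract := (realization_act R (Pfn_act_mono a)).

Definition subsets (D : {fset X}) : {fset Pfn X} :=
  [fset T in pmap insub (fpowerset D)].

Lemma in_subsets D (T : Pfn X) : (T \in subsets D) = (T `<=` D).
Proof. by rewrite !inE mem_pmap_sub fpowersetE. Qed.

Definition hull (A : {fset Pfn X}) : {fset X} := \bigcup_(T <- A) Pfn_val T.

Lemma hull_sub A (T : Pfn X) : T \in A -> T `<=` hull A.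
Proof. by move=> TA; apply: bigfcup_sup. Qed.

Lemma spread_inj (u v : space) : spread u =1 spread v -> u = v.
Proof.
move=> uv; apply: realizationP => S.
pose D := hull (finsupp u `|` finsupp v).
rewrite (@spreadK _ _ u S D) => [|T Tu]; last by rewrite hull_sub// inE Tu.
rewrite (@spreadK _ _ v S D) => [|T Tv]; last by rewrite hull_sub// inE Tv orbT.
by congr (_ * Num.max _ (_ - _)); apply: eq_bigr.
Qed.

Lemma spread_act g (w : space) x : spread (ract g w) (a g x) = spread w x.
Proof.
rewrite /spread /density sum_act; apply: eq_big => [T|T _].
  by rewrite mem_imfset//; exact: act_inj.
by rewrite coord_act /= card_imfset//; exact: act_inj.
Qed.

Lemma continuous_spread x : continuous (fun w : space => spread w x : R).
Proof.
apply: continuous_on_faces => A cA; apply/subspace_continuousP => u uA.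
pose F := within (face A) (nbhs u).
have cu : id v @[v --> F] --> u by apply: cvg_within_filter; exact: cvg_id.
rewrite /from_subspace /spread (density_sumE _ uA).
apply: (@cvg_trans _ (\sum_(T <- A | x \in Pfn_val T)
  (v : space) T / #|` T|%:R @[v --> F])).
  apply: near_eq_cvg; have : \forall v \near F, face A v by exact: withinT.
  by apply: filterS => v vA; rewrite (density_sumE _ vA).
apply: cvg_sumr => T _; apply: cvgM; last exact: cvg_cst.
exact: (continuous_cvg _ (@continuous_coord _ _ _ T u) cu).
Qed.

(** The point that divides the segment from [spread u] to [spread v] in the
full simplex; the value [u] is a placeholder for [s] outside [[0, 1]]. *)
Definition mix (u v : space) (s : R) : space :=
  xget u [set w | spread w =1 fun x => (1 - s) * spread u x + s * spread v x].

Lemma spread_mix u v s x : s \in `[0, 1] ->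
  spread (mix u v s) x = (1 - s) * spread u x + s * spread v x.
Proof.
rewrite in_itv /= => /andP[s0 s1].
pose D := hull (finsupp u `|` finsupp v).
have uD T : T \in finsupp u -> T `<=` D by move=> Tu; rewrite hull_sub// inE Tu.
have vD T : T \in finsupp v -> T `<=` D.
  by move=> Tv; rewrite hull_sub// inE Tv orbT.
have [|y yD||w wE] := @spread_surj R X
    (fun x => (1 - s) * spread u x + s * spread v x) D.
- move=> y; apply: addr_ge0; apply: mulr_ge0; rewrite ?subr_ge0//;
  exact: density_ge0.
- by rewrite (spread_out uD yD) (spread_out vD yD) !mulr0 addr0.
- by rewrite big_split /= -!big_distrr /= !sum_spread// !mulr1 subrK.
by rewrite /mix; case: xgetP => [w' _ /(_ x)//|/(_ w)]; case/(_ wE).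
Qed.

Lemma mix_supp (u v : space) s (D : {fset X}) : s \in `[0, 1] ->
  (forall T, T \in finsupp u -> T `<=` D) ->
  (forall T, T \in finsupp v -> T `<=` D) ->
  face (subsets D) (mix u v s).
Proof.
move=> sI uD vD; apply/fsubsetP => T Tw; rewrite in_subsets.
apply/fsubsetP => x xT; apply: contraTT (spread_gt0 Tw xT) => xD.
by rewrite spread_mix// (spread_out uD xD) (spread_out vD xD) !mulr0 addr0 ltxx.
Qed.

Lemma mix0 u v : mix u v 0 = u.
Proof.
apply: spread_inj => x; rewrite spread_mix ?in_itv /= ?lexx ?ler01//.
by rewrite subr0 mul1r mul0r addr0.
Qed.

Lemma mix1 u v : mix u v 1 = v.
Proof.
apply: spread_inj => x; rewrite spread_mix ?in_itv /= ?lexx ?ler01//.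
by rewrite subrr mul0r mul1r add0r.
Qed.

Lemma mix_act g u v s : s \in `[0, 1] ->
  mix (ract g u) (ract g v) s = ract g (mix u v s).
Proof.
move=> sI; apply: spread_inj => x; rewrite -[x](act_inv a g).
by rewrite spread_act !spread_mix// !spread_act.
Qed.

(** The straight-line homotopy in the full simplex on [X]. It commutes with the
action because the action on the full simplex is affine, and it is continuous
because [spreadK] expresses its coordinates through minima and maxima of
finitely many continuous functions. *)
Lemma locally_finite_maps_homotopic (d : Order.disp_t) (Q : porderType d)
    (b : gact G (realization R Q)) (r0 r1 : realization R Q -> space) :
  (forall A : {fset Q}, exists B, forall w, face A w ->
     face B (r0 w) /\ face B (r1 w)) ->
  continuous r0 -> continuous r1 ->
  equivariant b ract r0 -> equivariant b ract r1 ->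
  G_homotopic R b ract r0 r1.
Proof.
move=> r_fin c0 c1 e0 e1.
exists (fun z => mix (r0 z.1) (r1 z.1) z.2); split => [|w|w|s sI g w] /=.
- apply: homotopy_continuous_on_faces => A cA; have [B AB] := r_fin A.
  apply/subspace_continuousP => -[u s] [/= uA sI].
  set D := [set z : realization R Q * R | _].
  pose F := within D (nbhs (u, s)).
  have FD : \forall z \near F, D z by exact: withinT.
  have cu : z.1 @[z --> F] --> u by apply: cvg_within_filter; exact: cvg_fst.
  have cs : z.2 @[z --> F] --> s by apply: cvg_within_filter; exact: cvg_snd.
  pose E := hull B.
  have rE w : face A w ->
      (forall T, T \in finsupp (r0 w) -> T `<=` E) /\
      (forall T, T \in finsupp (r1 w) -> T `<=` E).
    by move=> /AB[/fsubsetP B0 /fsubsetP B1]; split=> T TR; apply: hull_sub;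
      [exact: B0|exact: B1].
  have mixE w r : face A w -> r \in `[0, 1] ->
      face (subsets E) (mix (r0 w) (r1 w) r).
    by move=> /rE[E0 E1] rI; exact: mix_supp.
  apply: (@cvg_face _ _ _ _ F _ _ _ (subsets E)).
  + exact: mixE.
  + by apply: filterS FD => -[w r] [/= wA rI]; exact: mixE.
  have cspread x : (1 - z.2) * spread (r0 z.1) x + z.2 * spread (r1 z.1) x
      @[z --> F] --> spread (mix (r0 u) (r1 u) s) x.
    rewrite spread_mix//; apply: cvgD; apply: cvgM => //.
    * by apply: cvgB => //; exact: cvg_cst.
    * apply: (continuous_cvg _ (@continuous_spread x (r0 u))).
      exact: (continuous_cvg _ (c0 u) cu).
    * apply: (continuous_cvg _ (@continuous_spread x (r1 u))).
      exact: (continuous_cvg _ (c1 u) cu).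
  have cmix x : spread (mix (r0 z.1) (r1 z.1) z.2) x
      @[z --> F] --> spread (mix (r0 u) (r1 u) s) x.
    apply: cvg_trans (cspread x); apply: near_eq_cvg.
    by apply: filterS FD => -[w r] [/= wA rI]; rewrite spread_mix.
  have mix_sub w r T : face A w -> r \in `[0, 1] ->
      T \in finsupp (mix (r0 w) (r1 w) r) -> T `<=` E.
    by move=> wA rI /(fsubsetP (mixE w r wA rI)); rewrite in_subsets.
  move=> S; rewrite /from_subspace /= (@spreadK _ _ _ S E); last first.
    by move=> T; exact: mix_sub.
  apply: (@cvg_trans _ (#|` S|%:R * Num.max 0
    (\big[Num.min/1]_(x <- Pfn_val S) spread (mix (r0 z.1) (r1 z.1) z.2) x -
     \big[Num.max/0]_(x <- E `\` Pfn_val S)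
       spread (mix (r0 z.1) (r1 z.1) z.2) x) @[z --> F])).
    apply: near_eq_cvg; apply: filterS FD => -[w r] [/= wA rI].
    by rewrite (@spreadK _ _ _ S E)// => T; exact: mix_sub.
  apply: cvgM; first exact: cvg_cst.
  apply: cvg_maxr; first exact: cvg_cst.
  apply: cvgB; apply: cvg_big => // -[x y].
  + by apply: cvg_minr; [exact: cvg_fst|exact: cvg_snd].
  + by apply: cvg_maxr; [exact: cvg_fst|exact: cvg_snd].
- exact: mix0.
- exact: mix1.
- by rewrite e0 e1 mix_act.
Qed.

End StraightLine.

(** * Points supported on a subposet *)

Section Corestriction.
Context (R : realType) (d : Order.disp_t) (P : porderType d) (p : pred P).
Local Notation sub := (realization R (subposet p)).

Lemma subposet_val_homo : {homo @subposet_val d P p : x y / (x <= y)%O}.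
Proof. by []. Qed.

Definition incl : sub -> realization R P := rmap subposet_val_homo.

Lemma incl_in (w : sub) x : incl w (subposet_val x) = w x.
Proof.
rewrite rmapE -[RHS]mass_pred1; apply: eq_bigl => y.
exact: (inj_eq val_inj).
Qed.

Lemma incl_out (w : sub) q : ~~ p q -> incl w q = 0.
Proof.
move=> pq; rewrite rmapE big1// => x /eqP xq.
by move: pq; rewrite -xq subposetP.
Qed.

Definition sub_fset (A : {fset P}) : {fset subposet p} :=
  [fset x in pmap insub A].

Lemma in_sub_fset A x : (x \in sub_fset A) = (subposet_val x \in A).
Proof. by rewrite !inE mem_pmap_sub. Qed.

(** Turns a map whose values are supported on the subposet, such as the
retraction, into a map to the realization of the subposet. *)
Lemma corestriction (w : realization R P) :
  (forall q, q \in finsupp w -> p q) -> {w' : sub | incl w' = w}.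
Proof.
move=> wp.
pose w' : {fsfun subposet p -> R with 0} :=
  [fsfun x in sub_fset (finsupp w) => w (subposet_val x)].
have w'E x : w' x = w (subposet_val x).
  by rewrite fsfun_fun in_sub_fset; case: finsuppP.
have bw : barycentric w'.
  have /and3P[cw w0 /eqP w1] := baryP w; apply/and3P; split.
  - apply/allrelP => x y; rewrite !mem_finsupp !w'E -!mem_finsupp => xw yw.
    exact: (allrelP cw _ _ xw yw).
  - by apply/allP => x _; rewrite w'E realization_ge0.
  rewrite (_ : \sum_(x <- _) _ = \sum_(x <- sub_fset (finsupp w)) w' x).
    under eq_bigr do rewrite w'E.
    transitivity
      (\sum_(q <- @subposet_val d P p @` sub_fset (finsupp w)) w q == 1).
      by rewrite [in RHS]big_imfset; [|move=> x y _ _; exact: val_inj].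
    rewrite -w1; apply/eqP; apply: eq_fbigl => q; apply/imfsetP/idP => /=.
      by move=> [x xw ->]; rewrite in_sub_fset in xw.
    by move=> qw; exists (Subposet (wp _ qw)); rewrite ?in_sub_fset.
  by apply: big_fset_incl => [|x _ /fsfun_dflt//]; exact: finsupp_sub.
exists (Realization bw); apply: realizationP => q.
case: (boolP (p q)) => pq; first by rewrite (incl_in _ (Subposet pq)) /= w'E.
rewrite incl_out//; apply/esym/fsfun_dflt; exact: contra (wp q) pq.
Qed.

End Corestriction.

(** * The Vietoris-Rips complex in the full realization *)

Section Sublevel.
Context (R : realType) (X : metricType R) (G : groupType) (a : gact G X).
Context (a_iso : isometric_act a) (a_cocompact : cocompact_act a).
Context (balls_finite : forall (x : X) (r : R), finite_set (ball x r)).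
Context (t : R) (zeta : Pfn X -> Pfn X).
Hypothesis zeta_equiv : equivariant (Pfn_act a) (Pfn_act a) zeta.
Hypothesis zeta_in : forall S : Pfn X, t < diam S -> zeta S `<=` S ->
  diam (zeta S) < diam S /\
  forall S' : Pfn X, S' `<=` S -> diam S' < diam S ->
    diam (S' `|` zeta S) < diam S.
Hypothesis zeta_out : forall S : Pfn X, t < diam S -> ~ (zeta S `<=` S) ->
  forall S' : Pfn X, S `<=` S' -> diam S' = diam S ->
    diam (S' `|` zeta S) = diam S.

Local Notation rk := (rank t).
Local Notation ract := (realization_act R (Pfn_act_mono a)).

Lemma link_pred_act2 g (S T : Pfn X) :
  link_pred (Pfn_act a g S) (Pfn_act a g T) = link_pred S T.
Proof.
rewrite /link_pred (inj_eq (@act_inj _ _ (Pfn_act a) g)) !morse_act//.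
by rewrite /Order.comparable !(act_le (Pfn_act_mono a)).
Qed.

Let rank_gt0 (S : Pfn X) : (0 < rk S)%N = (t < diam S).
Proof. by rewrite lt0n (rank_eq0 a_iso)// ltNge. Qed.

Let r : VRoo X -> VRoo X := retraction rk (@link_pred R X)
  (fun S T => Pfn_join T (apex zeta S)) (apex zeta).

Let rk_act g (S : Pfn X) : rk (Pfn_act a g S) = rk S.
Proof. exact: rank_act. Qed.

Let link_rk (S T : Pfn X) : (0 < rk S)%N -> link_pred S T -> (rk T < rk S)%N.
Proof.
by rewrite rank_gt0 => tS /and3P[_ _]; exact: (rank_lt a_iso).
Qed.

Let rk_link (S T : Pfn X) : (0 < rk S)%N -> (rk T <= rk S)%N -> T != S ->
  (T >=< S)%O -> link_pred S T.
Proof. by rewrite rank_gt0; exact: (link_of_rank a_iso). Qed.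

Let join_link (S T : Pfn X) : (0 < rk S)%N -> link_pred S T ->
  link_pred S (Pfn_join T (apex zeta S)).
Proof. by rewrite rank_gt0 => tS; apply: link_join; auto. Qed.

Let apex_link (S : Pfn X) : (0 < rk S)%N -> link_pred S (apex zeta S).
Proof. by rewrite rank_gt0 => tS; apply: link_apex; auto. Qed.

Let join_homo (S T U : Pfn X) : (T <= U)%O ->
  (Pfn_join T (apex zeta S) <= Pfn_join U (apex zeta S))%O.
Proof. exact: Pfn_join_homo. Qed.

Let r_face (A : {fset Pfn X}) :
  exists2 B : {fset Pfn X}, forall p, p \in B -> rk p = 0%N &
    forall w, face A w -> face B (r w).
Proof.
by apply: retraction_face => // *; rewrite ?Pfn_le_joinl ?Pfn_le_joinr.
Qed.

Let r_continuous : continuous r.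
Proof.
by apply: continuous_retraction => // *; rewrite ?Pfn_le_joinl ?Pfn_le_joinr.
Qed.

Let r_act : equivariant ract ract r.
Proof.
move=> g w; apply: retraction_act => // [*|h S T|h S|*|*].
- exact: link_pred_act2.
- by rewrite Pfn_join_act apex_act.
- by rewrite apex_act.
- exact: Pfn_le_joinl.
- exact: Pfn_le_joinr.
Qed.

Let r_sub w (q : Pfn X) : q \in finsupp (r w) -> diam_le t q.
Proof.
have [B B0 rB] := r_face (finsupp w).
move=> /(fsubsetP (rB w (fsubset_refl _)))/B0 /eqP.
by rewrite (rank_eq0 a_iso).
Qed.

Let h (w : VRoo X) : VR X t := sval (corestriction (@r_sub w)).

Let incl_h w : incl (h w) = r w.
Proof. exact: (svalP (corestriction (@r_sub w))). Qed.

Let hE w x : h w x = r w (subposet_val x).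
Proof. by rewrite -incl_in incl_h. Qed.

Let incl_act g (w : VR X t) :
  incl (VR_act a_iso t g w) = VRoo_act a g (incl w).
Proof.
apply: (@realization_eq_act _ _ _ _ (Pfn_act a) g) => q.
rewrite [RHS]coord_act; case: (boolP (diam_le t q)) => tq.
  rewrite (incl_in _ (Subposet tq)) -(@coord_act _ _ _ _ _
    (subposet_act_mono (Pfn_act_mono a) (diam_le_act a_iso (t := t))) g).
  by rewrite -[RHS]incl_in.
by rewrite !incl_out//; apply: contra tq; rewrite /diam_le diam_act.
Qed.

(** The inclusion and the retraction are inverse to each other up to homotopy:
one composite is the identity, and the other is an equivariant map of the full
complex to itself, where all such maps are homotopic. *)
Lemma VR_equiv_VRoo : G_homotopy_equiv R (VR_act a_iso t) (VRoo_act a).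
Proof.
exists (@incl R _ _ _), h; split.
- by split; [exact: rmap_continuous|exact: incl_act].
- split.
    apply: continuous_on_faces => A cA; apply/subspace_continuousP => u uA.
    pose F := within (face A) (nbhs u).
    have FA : \forall v \near F, face A v by exact: withinT.
    have cu : id v @[v --> F] --> u by apply: cvg_within_filter; exact: cvg_id.
    have [B B0 rB] := r_face A.
    have hB w : face A w -> face (sub_fset (diam_le t) B) (h w).
      move=> wA; apply/fsubsetP => x; rewrite mem_finsupp hE -mem_finsupp.
      by rewrite in_sub_fset; exact: (fsubsetP (rB w wA)).
    apply: (@cvg_face _ _ _ _ F _ _ _ (sub_fset (diam_le t) B)).
    + exact: hB.
    + by apply: filterS FA => v; exact: hB.
    move=> x; rewrite /from_subspace hE; under eq_fun do rewrite hE.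
    apply: (continuous_cvg _ (@continuous_coord _ _ _ (subposet_val x) (r u))).
    exact: (continuous_cvg _ (@r_continuous u) cu).
  move=> g w; apply: (@realization_eq_act _ _ _ _
    (subposet_act (diam_le_act a_iso (t := t))) g) => x.
  by rewrite [RHS]coord_act !hE r_act [LHS]coord_act.
- have -> : h \o incl (p := diam_le t) = id.
    apply/funext => w; apply: realizationP => x; rewrite /= hE /r.
    rewrite retraction_id ?incl_in// => q; rewrite mem_finsupp => qw.
    apply/eqP; rewrite (rank_eq0 a_iso)//; apply: contraNT qw => tq.
    by rewrite incl_out.
  exists fst; split => //.
  by apply: continuous_subspaceT => z; exact: cvg_fst.
- have -> : incl (p := diam_le t) \o h = r.
    by apply/funext => w; exact: incl_h.
  apply: locally_finite_maps_homotopic => //.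
  + move=> A; have [B _ rB] := r_face A; exists (A `|` B) => w wA; split.
      exact: fsubset_trans (rB w wA) (fsubsetUr _ _).
    exact: fsubset_trans wA (fsubsetUl _ _).
  + by move=> w; exact: cvg_id.
Qed.

End Sublevel.

(** * The theorem *)

Theorem proposition3p4 (R : realType) (X : metricType R) (G : groupType)
    (a : gact G X) (a_iso : isometric_act a) (a_cocompact : cocompact_act a)
    (t : R) (t_gt0 : 0 < t)
    (balls_finite : forall (x : X) (r : R), finite_set (ball x r))
    (zeta : Pfn X -> Pfn X)
    (zeta_equiv : equivariant (Pfn_act a) (Pfn_act a) zeta)
    (zeta_in : forall S : Pfn X, t < diam S -> zeta S `<=` S ->
       diam (zeta S) < diam S /\
       forall S' : Pfn X, S' `<=` S -> diam S' < diam S ->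
         diam (S' `|` zeta S) < diam S)
    (zeta_out : forall S : Pfn X, t < diam S -> ~ (zeta S `<=` S) ->
       forall S' : Pfn X, S `<=` S' -> diam S' = diam S ->
         diam (S' `|` zeta S) = diam S) :
  (forall S : Pfn X, t < diam S -> G_contractible R (lk_act a_iso S)) /\
  G_homotopy_equiv R (VR_act a_iso t) (VRoo_act a).
Proof.
split=> [S tS|]; last by apply: VR_equiv_VRoo zeta_equiv zeta_in zeta_out.
by apply: link_contractible zeta_equiv _ _; auto.
Qed.
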